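(* Let $d\ge3$ and $\ell\in\mathbb{N}$, and let $\{Y_\ell^m\}_{m=1}^{N(d,\ell)}$ be an orthonormal basis (in $L^2(S^d,d\sigma_d)$) of the space of complex spherical harmonics of degree $\ell$ on $S^d$. Then for every $j=1,\dots,d$ and every $\hat\theta\in S^d$ (away from coordinate singularities), $$\sum_{m=1}^{N(d,\ell)}\frac{1}{\eta_j^2}\,\bigl|\partial_{\theta_j}Y_\ell^m(\hat\theta)\bigr|^2=(d-1)\,K(d,\ell)\,C_{\ell-1}^{(\frac{d+1}{2})}(1),\qquad K(d,\ell)=\frac{N(d,\ell)}{|S^d|\,C_\ell^{(\frac{d-1}{2})}(1)},$$ with the convention $C_{-1}^{(\alpha)}\equiv0$.
   Context: Hyperspherical coordinates on $\mathbb{R}^{d+1}$: $x_{d+1}=r\cos\theta_d$, $x_d=r\sin\theta_d\cos\theta_{d-1}$, …, $x_3=r\sin\theta_d\cdots\sin\theta_3\cos\theta_2$, $x_2=r\sin\theta_d\cdots\sin\theta_2\sin\theta_1$, $x_1=r\sin\theta_d\cdots\sin\theta_2\cos\theta_1$, with $\theta_1\in[0,2\pi)$, $\theta_2,\dots,\theta_d\in[0,\pi]$. Define $\eta_j=\prod_{i=j+1}^d\sin\theta_i$ (so $\eta_d=1$); the surface measure is $d\sigma_d=\prod_{j=2}^d\sin^{j-1}\theta_j\,d\theta_1\cdots d\theta_d$, and $|S^d|$ is the surface area of $S^d$. $N(d,0)=1$, $N(d,\ell)=\binom{d+\ell}{d}-\binom{d+\ell-2}{d}$ for $\ell\ge1$.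 $C_n^{(\alpha)}$ denotes the Gegenbauer polynomial of degree $n$ with the standard normalisation ($C_n^{(\alpha)}(1)=(2\alpha)_n/n!$). *)

(* Defs.v *)
From mathcomp Require Import all_boot all_order all_algebra.
From mathcomp Require Import all_classical all_reals all_analysis.
From mathcomp Require Import complex.
From mathcomp Require mpoly.
Import (canonicals) mpoly.

Set Implicit Arguments.
Unset Strict Implicit.
Unset Printing Implicit Defensive.

Import Order.TTheory GRing.Theory Num.Theory.
Local Open Scope ring_scope.
Local Open Scope classical_set_scope.

Section SphericalHarmonics.
Variable R : realType.

(* Angles: theta : nat -> R, only the entries theta 1, ..., theta d matter. *)

Definition upd (theta : nat -> R) (j : nat) (t : R) : nat -> R :=
  fun i => if i == j then t else theta i.

(* Hyperspherical coordinates of the point of S^d (r = 1) with angles theta.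
   Index k : 'I_d.+1 stands for the coordinate x_{k+1}:
     x_1 = sin th_d ... sin th_2 cos th_1,
     x_2 = sin th_d ... sin th_2 sin th_1,
     x_{k+1} = sin th_d ... sin th_{k+1} cos th_k   (2 <= k <= d). *)
Definition xcoord (d : nat) (theta : nat -> R) (k : 'I_d.+1) : R :=
  if val k == 0%N then (\prod_(2 <= i < d.+1) sin (theta i)) * cos (theta 1%N)
  else if val k == 1%N then (\prod_(2 <= i < d.+1) sin (theta i)) * sin (theta 1%N)
  else (\prod_(k.+1 <= i < d.+1) sin (theta i)) * cos (theta (val k)).

Definition eta (d j : nat) (theta : nat -> R) : R :=
  \prod_(j.+1 <= i < d.+1) sin (theta i).

(* Integration against the surface measure
   d sigma_d = prod_{j=2}^d sin^{j-1} theta_j dtheta_1 ... dtheta_d,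
   theta_1 in [0, 2 pi), theta_2, ..., theta_d in [0, pi],
   written as an iterated Lebesgue integral. *)

Definition angle_dom (j : nat) : set R :=
  if j == 1%N then `[0, 2 * pi[%classic else `[0, pi]%classic.

Fixpoint iter_int (n : nat) (F : (nat -> R) -> R) (theta : nat -> R) : R :=
  match n with
  | 0 => F theta
  | n'.+1 => \int[lebesgue_measure]_(t in angle_dom n'.+1)
               iter_int n' F (upd theta n'.+1 t)
  end.

Definition sphere_int (d : nat) (f : (nat -> R) -> R) : R :=
  iter_int d (fun theta => f theta * \prod_(2 <= j < d.+1) sin (theta j) ^+ j.-1)
    (fun _ => 0).

Definition sphere_cint (d : nat) (f : (nat -> R) -> R[i]) : R[i] :=
  Complex (sphere_int d (fun th => complex.Re (f th))) (sphere_int d (fun th => complex.Im (f th))).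

Definition sphere_area (d : nat) : R := sphere_int d (fun _ => 1).

Definition L2dot (d : nat) (f g : ('I_d.+1 -> R) -> R[i]) : R[i] :=
  sphere_cint d (fun th => f (@xcoord d th) * conjc (g (@xcoord d th))).

Definition homog_harmonic (n l : nat) (P : mpoly.mpoly n R[i]) : Prop :=
  P \is mpoly.ishomog1 l (mpoly.Measure.clone n (@mpoly.mdeg n) _) /\
  \sum_(k < n) mpoly.mderiv k (mpoly.mderiv k P) = 0.

Definition on_sphere (d : nat) (x : 'I_d.+1 -> R) : Prop :=
  \sum_(k < d.+1) x k ^+ 2 = 1.

Definition spherical_harmonic (d l : nat) (Y : ('I_d.+1 -> R) -> R[i]) : Prop :=
  exists P : mpoly.mpoly d.+1 R[i], homog_harmonic l P /\
    forall x, on_sphere x -> Y x = mpoly.meval (fun k => (x k)%:C%C) P.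

Definition sph_harm_ONB (d l N : nat) (Y : 'I_N -> ('I_d.+1 -> R) -> R[i]) : Prop :=
  [/\ forall m, spherical_harmonic l (Y m),
      forall m n, L2dot (Y m) (Y n) = (m == n)%:R &
      forall Z, spherical_harmonic l Z ->
        exists c : 'I_N -> R[i], forall x, on_sphere x ->
          Z x = \sum_(m < N) c m * Y m x].

Definition dtheta (d j : nat) (Y : ('I_d.+1 -> R) -> R[i]) (theta : nat -> R) : R[i] :=
  let g := fun t => Y (@xcoord d (upd theta j t)) in
  Complex ((fun t => complex.Re (g t))^`() (theta j)) ((fun t => complex.Im (g t))^`() (theta j)).

Definition sqmod (z : R[i]) : R := complex.Re z ^+ 2 + complex.Im z ^+ 2.

(* Gegenbauer polynomials C_n^(alpha)(x), via the three-term recurrence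
   C_0 = 1, C_1 = 2 alpha x,
   n C_n = 2 x (n + alpha - 1) C_{n-1} - (n + 2 alpha - 2) C_{n-2}. *)
Fixpoint gegenbauer_pair (alpha x : R) (n : nat) : R * R :=
  match n with
  | 0 => (1, 2 * alpha * x)
  | n'.+1 => let: (a, b) := gegenbauer_pair alpha x n' in
      (b, (2 * x * (n'.+1%:R + alpha) * b - (n'%:R + 2 * alpha) * a) / n'.+2%:R)
  end.

Definition gegenbauer (alpha : R) (n : nat) (x : R) : R :=
  (gegenbauer_pair alpha x n).1.

Definition gegenbauer_pred (alpha : R) (n : nat) (x : R) : R :=
  if n is n'.+1 then gegenbauer alpha n' x else 0.


End SphericalHarmonics.

(* dimension N(d,l) of the space of spherical harmonics of degree l *)
Definition Nsh (d l : nat) : nat :=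
  if l is 0 then 1 else ('C(d + l, d) - 'C(d + l - 2, d))%N.

Definition Kconst (R : realType) (d l : nat) : R :=
  (Nsh d l)%:R / (sphere_area R d * gegenbauer ((d%:R - 1) / 2) l 1).

(* Main.v *)
(** Let [P_m] be the homogeneous harmonic polynomials representing the
    orthonormal basis.  In hyperspherical coordinates the integral of a
    monomial is a product of one-variable trigonometric integrals; their
    recurrences give [(|m| + d + 1) M(m + 2 e_a) = (m_a + 1) M(m)] for the
    moments, from which the integral over the sphere of any infinitesimal
    rotation of a polynomial vanishes.  Hence an infinitesimal rotation acts on
    the basis by a skew-Hermitian matrix.

    Fix a point x and let [g(u)] be the vector of the derivatives of the [P_m]
    at x in a tangent direction u.  The rotation in the plane of two orthogonal
    tangent directions v, w fixes x and its matrix exchanges [g(v)] and [g(w)]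
    up to sign and scale, so [|g(u)|^2 = |u|^2 |g(v)|^2] for v a unit vector.
    Summing over the projections of the coordinate vectors on the tangent space
    and moving one rotation to the other side of the Hermitian form yields the
    spherical Laplacian, so that
    [d |g(v)|^2 = l (l + d - 1) sum_m |P_m(x)|^2].
    The last sum has zero angular derivatives, so it is a constant c, and integrating
    it gives [c |S^d| = N].
    The degenerate case [|S^d| = 0] would force [N = 0], when both sides
    vanish. *)

From HB Require Import structures.
Require Import Defs.
From mathcomp Require Import all_boot all_order all_algebra.
From mathcomp Require Import all_classical all_reals all_analysis.
From mathcomp Require Import complex ring zify.
From mathcomp Require mpoly.
Import (canonicals) mpoly.
Import (coercions) mpoly.
Import Order.TTheory GRing.Theory Num.Theory.
Import numFieldNormedType.Exports.
Local Open Scope ring_scope.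

Set Implicit Arguments.
Unset Strict Implicit.
Unset Printing Implicit Defensive.

(** * Trigonometric integrals *)

Section TrigIntegrals.
Variable R : realType.
Local Notation mu := (@lebesgue_measure R).
Implicit Types (a b m : nat) (t : R).

Definition angle_int (k : nat) (f : R -> R) : R :=
  \int[mu]_(t in @angle_dom R k) f t.

Definition angle_sup (k : nat) : R := if k == 1%N then 2 * pi else pi.

Lemma continuous_integrable_angle k (f : R -> R) : continuous f ->
  mu.-integrable (@angle_dom R k) (EFin \o f).
Proof.
move=> cf.
have H c : mu.-integrable `[0, c]%classic (EFin \o f).
  by apply: continuous_compact_integrable; [exact: segment_compact|
    exact: continuous_subspaceT].
rewrite /angle_dom; case: ifP => _; last exact: H.
by apply: (integrableS _ _ _ (H (2 * pi))) => //; exact: subset_itv_co_cc.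
Qed.

Lemma measurable_angle_dom k : measurable (@angle_dom R k).
Proof. by rewrite /angle_dom; case: ifP. Qed.

(** Continuity on a bounded domain settles all integrability conditions here, so later linear
    manipulations of trigonometric sums need none. *)
Lemma angle_int_sum (T : Type) (s : seq T) (P : pred T) k (c : T -> R)
    (f : T -> R -> R) :
  (forall i, continuous (f i)) ->
  angle_int k (fun t => \sum_(i <- s | P i) c i * f i t) =
  \sum_(i <- s | P i) c i * angle_int k (f i).
Proof.
move=> cf.
have cc i : continuous (fun t => c i * f i t).
  by move=> t; apply: cvgM; [exact: cvg_cst|exact: cf].
have cs s' : continuous (fun t => \sum_(i <- s' | P i) c i * f i t).
  elim: s' => [|i s' IH] t.
    rewrite (_ : (fun _ => _) = fun=> 0); first exact: cvg_cst.
    by apply/funext => u; rewrite big_nil.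
  under eq_fun do rewrite big_cons.
  by case: ifP => _; [apply: cvgD; [exact: cc|exact: IH]|exact: IH].
elim: s => [|i s IH].
  rewrite big_nil /angle_int.
  rewrite (_ : (fun _ => _) = fun=> 0); last first.
    by apply/funext => u; rewrite big_nil.
  by rewrite Rintegral_cst ?mul0r//; exact: measurable_angle_dom.
rewrite big_cons; under [X in angle_int _ X]eq_fun do rewrite big_cons.
case: ifP => Pi; last exact: IH.
rewrite /angle_int RintegralD.
- by congr (_ + _); [rewrite RintegralZl//;
   [exact: measurable_angle_dom|exact: continuous_integrable_angle]|exact: IH].
- exact: measurable_angle_dom.
- exact: continuous_integrable_angle.
- exact: continuous_integrable_angle.
Qed.

Lemma angle_int_derive k (f F : R -> R) : continuous f ->
  (forall t, is_derive t 1 F (f t)) ->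
  angle_int k f = F (angle_sup k) - F 0.
Proof.
move=> cf dF.
have FTC c : 0 < c -> \int[mu]_(t in `[0, c]) f t = F c - F 0.
  move=> c0; rewrite /Rintegral (@continuous_FTC2 _ f F)//.
  - exact: continuous_subspaceT.
  - have cF : continuous F.
      move=> t; apply: differentiable_continuous; apply/derivable1_diffP.
      by case: (dF t).
    split.
    + by move=> t _; case: (dF t).
    + by apply: cvg_at_right_filter; exact: cF.
    + by apply: cvg_at_left_filter; exact: cF.
  - by move=> t _; rewrite derive1E; case: (dF t).
have p0 : (0:R) < pi by exact: pi_gt0.
rewrite /angle_int /angle_sup; have := @continuous_integrable_angle k f cf.
rewrite /angle_dom; case: ifP => _ intf; last exact: FTC.
(* The endpoint [2 * pi] missing from the half-open domain is negligible. *)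
by rewrite Rintegral_itv_bndo_bndc//; apply: FTC; rewrite mulr_gt0.
Qed.

Definition cs_mono b a : R -> R := fun t => cos t ^+ b * sin t ^+ a.

Lemma is_derive_cs_mono b a t :
  is_derive t 1 (cs_mono b a)
   (a%:R * (cos t ^+ b.+1 * sin t ^+ a.-1) - b%:R * (cos t ^+ b.-1 * sin t ^+ a.+1)).
Proof.
have -> : cs_mono b a = @cos R ^+ b * @sin R ^+ a.
  by apply/funext => u; rewrite !exprfctE.
apply: is_derive_eq.
by rewrite /GRing.scale /= !exprfctE !exprS; ring.
Qed.

Lemma continuous_cs_mono b a : continuous (cs_mono b a).
Proof.
move=> t; apply: differentiable_continuous; apply/derivable1_diffP.
by case: (is_derive_cs_mono b a t).
Qed.

Definition trig_int k b a : R := angle_int k (cs_mono b a).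

(** The difference of the two sides is the integral of the derivative of [cs_mono b a]. The boundary
    terms cancel because the sine vanishes at 0 and [pi] when [0 < a], and by periodicity on the
    full circle. A truncated predecessor always carries a zero coefficient. *)
Lemma trig_int_ibp k b a : (0 < a)%N || (k == 1%N) ->
  a%:R * trig_int k b.+1 a.-1 = b%:R * trig_int k b.-1 a.+1.
Proof.
move=> ha; apply/eqP; rewrite -subr_eq0 -mulNr; apply/eqP.
(* The difference is written as a sum over two booleans so that [angle_int_sum] applies. *)
pose c (i : bool) : R := if i then a%:R else - b%:R.
pose f (i : bool) := if i then cs_mono b.+1 a.-1 else cs_mono b.-1 a.+1.
have <- : angle_int k (fun t => \sum_(i <- [:: true; false] | predT i) c i * f i t) =
   a%:R * trig_int k b.+1 a.-1 + - b%:R * trig_int k b.-1 a.+1.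
  rewrite angle_int_sum; first by rewrite !big_cons big_nil addr0.
  by case; exact: continuous_cs_mono.
set g := (fun t => _).
have dg t : is_derive t 1 (cs_mono b a) (g t).
  rewrite /g !big_cons big_nil addr0 /= mulNr.
  exact: is_derive_cs_mono.
have cg : continuous g.
  rewrite /g => t; under eq_fun do rewrite !big_cons big_nil addr0 /=.
  by apply: cvgD; (apply: cvgM; [exact: cvg_cst|exact: continuous_cs_mono]).
rewrite (angle_int_derive k cg dg).
rewrite /angle_sup /cs_mono; case: ifP ha => _; rewrite ?orbF ?orbT => ha.
  by rewrite mulr_natl cos2pi sin2pi cos0 sin0 subrr.
by rewrite sinpi sin0 expr0n -(prednK ha) !mulr0 subrr.
Qed.

Lemma trig_int_pyth k b a :
  trig_int k b a = trig_int k b.+2 a + trig_int k b a.+2.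
Proof.
have -> : trig_int k b a = angle_int k (fun t => \sum_(i <- [:: true; false] | predT i)
   (fun=> 1) i * (if i then cs_mono b.+2 a else cs_mono b a.+2) t).
  congr angle_int; apply/funext => t; rewrite !big_cons big_nil addr0 /= /cs_mono !mul1r.
  transitivity (cos t ^+ b * sin t ^+ a * (cos t ^+ 2 + sin t ^+ 2)).
    by rewrite cos2Dsin2 mulr1.
  by rewrite !exprS; ring.
rewrite angle_int_sum; first by rewrite !big_cons big_nil addr0 /= !mul1r.
by case; exact: continuous_cs_mono.
Qed.

Lemma trig_int_cos1 k a : trig_int k 1 a = 0.
Proof.
have /= := @trig_int_ibp k 0 a.+1 isT.
by rewrite mul0r => /eqP; rewrite mulf_eq0 pnatr_eq0 => /eqP.
Qed.

(** Here the full circle is essential: the sine has a positive integral over [[0, pi]]. *)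
Lemma trig_int_sin1 b : trig_int 1 b 1 = 0.
Proof.
have /= := @trig_int_ibp 1 b.+1 0 isT.
by rewrite mul0r => /esym/eqP; rewrite mulf_eq0 pnatr_eq0 => /eqP.
Qed.

(** Integration by parts at exponents [b.+1], [a.+1] relates the two integrals into which the
    Pythagorean identity splits [trig_int k b a]. *)
Lemma trig_int_cosSS k b a :
  (b + a + 2)%:R * trig_int k b.+2 a = b.+1%:R * trig_int k b a.
Proof.
have /= := @trig_int_ibp k b.+1 a.+1 isT.
rewrite (trig_int_pyth k b a) (mulrDr b.+1%:R) => <-.
by rewrite -mulrDl -natrD; congr (_%:R * _); lia.
Qed.

Lemma trig_int_sinSS k b a :
  (b + a + 2)%:R * trig_int k b a.+2 = a.+1%:R * trig_int k b a.
Proof.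
have /= := @trig_int_ibp k b.+1 a.+1 isT.
rewrite (trig_int_pyth k b a) (mulrDr a.+1%:R) => ->.
by rewrite -mulrDl -natrD; congr (_%:R * _); lia.
Qed.

End TrigIntegrals.

(** * Moments of the surface measure *)

Section MonomialIntegrals.
Variable R : realType.
Implicit Types (m : nat -> nat) (theta : nat -> R).

(** Natural indices, in place of ordinals depending on [d], allow induction on the dimension. *)
Definition xnat d theta (k : nat) : R :=
  if k == 0%N then (\prod_(2 <= i < d.+1) sin (theta i)) * cos (theta 1%N)
  else if k == 1%N then (\prod_(2 <= i < d.+1) sin (theta i)) * sin (theta 1%N)
  else (\prod_(k.+1 <= i < d.+1) sin (theta i)) * cos (theta k).

Lemma xcoordE d theta (k : 'I_d.+1) : xcoord theta k = xnat d theta k.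
Proof. by []. Qed.

Lemma xnat_low d theta k : (0 < d)%N -> (k <= d)%N ->
  xnat d.+1 theta k = sin (theta d.+1) * xnat d theta k.
Proof.
move=> d0 kd; rewrite /xnat.
case: ifP => _; first by rewrite big_nat_recr//=; ring.
case: ifP => _; first by rewrite big_nat_recr//=; ring.
by rewrite big_nat_recr//=; ring.
Qed.

Lemma xnat_top d theta : (0 < d)%N -> xnat d.+1 theta d.+1 = cos (theta d.+1).
Proof. by case: d => // d _; rewrite /xnat /= big_geq// mul1r. Qed.

(* Exponents of [sin (theta k)] and [cos (theta k)] in the monomial [x^m] times
   the surface density; the first two coordinates share the angle [theta 1]. *)
Definition sin_exponent m k : nat :=
  if k == 1%N then m 1%N else (\sum_(0 <= i < k) m i + k.-1)%N.

Definition cos_exponent m k : nat := if k == 1%N then m 0%N else m k.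

Definition mono_factor m k : R -> R :=
  @cs_mono R (cos_exponent m k) (sin_exponent m k).

(** Separation of variables: monomial times density is a product of functions of one angle each. In
    the induction on [d], the new angle multiplies every old coordinate by its sine. *)
Lemma weighted_monomial d theta m : (0 < d)%N ->
  (\prod_(0 <= i < d.+1) xnat d theta i ^+ m i) *
    \prod_(2 <= j < d.+1) sin (theta j) ^+ j.-1 =
  \prod_(1 <= k < d.+1) mono_factor m k (theta k).
Proof.
case: d => // d _; elim: d => [|d IH].
  rewrite big_nat_recr//= big_nat1 big_geq// mulr1 big_nat1 /xnat /=.
  by rewrite !(big_geq (leqnn 2)) !mul1r.
rewrite [RHS]big_nat_recr//= -IH big_nat_recr//= xnat_top//.
have -> : \prod_(0 <= i < d.+2) xnat d.+2 theta i ^+ m i =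
    sin (theta d.+2) ^+ (\sum_(0 <= i < d.+2) m i)%N *
    \prod_(0 <= i < d.+2) xnat d.+1 theta i ^+ m i.
  rewrite -prodrXr -big_split /= !big_nat; apply: eq_bigr => i /andP[_ id].
  by rewrite xnat_low// exprMn.
rewrite (big_nat_recr d.+2 2)//= /mono_factor /cs_mono /cos_exponent /sin_exponent /=.
rewrite exprD; ring.
Qed.

Definition sphere_moment d m : R :=
  \prod_(1 <= k < d.+1) trig_int R k (cos_exponent m k) (sin_exponent m k).

(** The induction keeps track of a partial integration: the first [n] angles are integrated out, the
    remaining ones are still free. *)
Lemma iter_int_sum_prod (T : Type) (s : seq T) (c : T -> R)
    (f : T -> nat -> R -> R) d n theta :
  (forall i k, continuous (f i k)) -> (n <= d)%N ->
  iter_int n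
    (fun th => \sum_(i <- s) c i * \prod_(1 <= k < d.+1) f i k (th k)) theta =
  \sum_(i <- s) c i * ((\prod_(1 <= k < n.+1) angle_int k (f i k)) *
     \prod_(n.+1 <= k < d.+1) f i k (theta k)).
Proof.
move=> cf; elim: n theta => [|n IH] theta nd /=.
  by apply: eq_bigr => i _; rewrite [in RHS]big_geq// mul1r.
under eq_Rintegral => t _ do rewrite (IH _ (ltnW nd)).
transitivity (angle_int n.+1 (fun t => \sum_(i <- s)
   (c i * ((\prod_(1 <= k < n.+1) angle_int k (f i k)) *
    \prod_(n.+2 <= k < d.+1) f i k (theta k))) * f i n.+1 t)).
  congr angle_int; apply/funext => t; apply: eq_bigr => i _.
  rewrite [X in _ * (_ * X)]big_ltn ?ltnS//.
  rewrite [upd theta n.+1 t n.+1]/upd eqxx.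
  have -> : \prod_(n.+2 <= k < d.+1) f i k (upd theta n.+1 t k) =
            \prod_(n.+2 <= k < d.+1) f i k (theta k).
    rewrite !big_nat; apply: eq_bigr => k /andP[kn _].
    by rewrite /upd gtn_eqF.
  ring.
rewrite angle_int_sum//; apply: eq_bigr => i _.
rewrite (big_nat_recr n.+1)//=; ring.
Qed.

Lemma sphere_int_monomials (T : Type) (s : seq T) (c : T -> R)
    (m : T -> nat -> nat) d : (0 < d)%N ->
  sphere_int d (fun th => \sum_(i <- s)
     c i * \prod_(0 <= k < d.+1) xnat d th k ^+ m i k) =
  \sum_(i <- s) c i * sphere_moment d (m i).
Proof.
move=> d0; rewrite /sphere_int.
have -> : (fun th => (\sum_(i <- s)
      c i * \prod_(0 <= k < d.+1) xnat d th k ^+ m i k) *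
      \prod_(2 <= j < d.+1) sin (th j) ^+ j.-1) =
    (fun th => \sum_(i <- s) c i *
      \prod_(1 <= k < d.+1) mono_factor (m i) k (th k)).
  apply/funext => th; rewrite mulr_suml; apply: eq_bigr => i _.
  by rewrite -mulrA weighted_monomial.
rewrite (@iter_int_sum_prod _ s c (fun i => mono_factor (m i)) d d)//; last first.
  by move=> i k; exact: continuous_cs_mono.
by apply: eq_bigr => i _; rewrite [X in _ * (_ * X)]big_geq// mulr1.
Qed.

Definition mnm_incr m a : nat -> nat := fun i => (m i + (i == a).*2)%N.

Lemma sum_mnm_incr m a k :
  (\sum_(0 <= i < k) mnm_incr m a i = \sum_(0 <= i < k) m i + (a < k).*2)%N.
Proof.
elim: k => [|k IH]; first by rewrite !big_geq.
rewrite !big_nat_recr//= IH /mnm_incr ltnS leq_eqVlt eq_sym; lia.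
Qed.

(** Induction on the dimension, starting from the circle, where the one-variable recurrences for
    cosine and sine are exactly the claim. *)
Lemma sphere_moment_incr d m a : (0 < d)%N -> (a <= d)%N ->
  (\sum_(0 <= i < d.+1) m i + d.+1)%:R * sphere_moment d (mnm_incr m a) =
  (m a).+1%:R * sphere_moment d m.
Proof.
rewrite /sphere_moment; case: d => // d _; elim: d => [|d IH] ad.
  rewrite !big_nat1 big_nat_recr//= big_nat1 /cos_exponent /sin_exponent /=.
  case: a ad => [|[|//]] _; rewrite /mnm_incr /= addn0 addn2.
    by rewrite [(m 0 + 1.*2)%N]addn2 -trig_int_cosSS addn2.
  by rewrite [(m 1 + 1.*2)%N]addn2 -trig_int_sinSS addn2.
rewrite (big_nat_recr d.+2 1)//= [in RHS](big_nat_recr d.+2 1)//=.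
rewrite /cos_exponent /sin_exponent /= sum_mnm_incr.
rewrite (big_nat_recr d.+2 0)//=.
(* Raising an old coordinate also raises the power of the sine of the last angle by two. The
   numerator of its recurrence is exactly the factor required by the induction hypothesis. *)
have [ad'|ad'] := leqP a d.+1.
  have -> : mnm_incr m a d.+2 = m d.+2 by rewrite /mnm_incr gtn_eqF ?ltnS// addn0.
  rewrite ltnS ad' [(_ + 1.*2 + _)%N](_ : _ = (\sum_(0 <= i < d.+2) m i + d.+1).+2); last by lia.
  rewrite [in RHS]mulrA -IH//.
  have := trig_int_sinSS R d.+2 (m d.+2) (\sum_(0 <= i < d.+2) m i + d.+1).
  set S := (\sum_(0 <= i < d.+2) m i)%N.
  set P := \prod_(_ <= _ < _) _.
  rewrite (_ : (_ + (S + d.+1) + 2 = S + m d.+2 + d.+3)%N); last by lia.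
  rewrite (_ : (S + d.+2 = (S + d.+1).+1)%N); last by lia.
  move=> H; transitivity (P * ((S + m d.+2 + d.+3)%:R * trig_int R d.+2 (m d.+2) (S + d.+1).+2)).
    ring.
  rewrite H; ring.
(* The last coordinate is the cosine of the last angle alone, so all earlier factors are
   unchanged. *)
have -> : a = d.+2 by lia.
have -> : mnm_incr m d.+2 d.+2 = (m d.+2).+2 by rewrite /mnm_incr eqxx addn2.
rewrite ltnn addn0.
have -> : \prod_(1 <= k < d.+2) trig_int R k (cos_exponent (mnm_incr m d.+2) k)
            (sin_exponent (mnm_incr m d.+2) k) =
  \prod_(1 <= k < d.+2) trig_int R k (cos_exponent m k) (sin_exponent m k).
  rewrite !big_nat; apply: eq_bigr => k /andP[k1 kd].
  rewrite /cos_exponent /sin_exponent sum_mnm_incr /mnm_incr.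
  by rewrite (ltn_eqF kd) (ltnNge d.+2) (ltnW kd) !addn0.
have := trig_int_cosSS R d.+2 (m d.+2) (\sum_(0 <= i < d.+2) m i + d.+1).
set S := (\sum_(0 <= i < d.+2) m i)%N.
set P := \prod_(_ <= _ < _) _.
rewrite (_ : (_ + (S + d.+1) + 2 = S + m d.+2 + d.+3)%N); last by lia.
move=> H; transitivity (P * ((S + m d.+2 + d.+3)%:R * trig_int R d.+2 (m d.+2).+2 (S + d.+1))).
  ring.
rewrite H; ring.
Qed.

(** One factor of the product vanishes: the one for the angle whose cosine (or, for the coordinate
    1, sine) occurs to the first power. *)
Lemma sphere_moment_odd d m a : (0 < d)%N -> (a <= d)%N -> m a = 1%N ->
  sphere_moment d m = 0.
Proof.
move=> d0 ad ma; rewrite /sphere_moment.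
have [k [k1 kd k0]] : exists k, [/\ (0 < k)%N, (k < d.+1)%N &
    trig_int R k (cos_exponent m k) (sin_exponent m k) = 0].
  case: a ad ma => [|[|a]] ad ma.
  - by exists 1%N; rewrite /cos_exponent /= ma trig_int_cos1.
  - by exists 1%N; rewrite /sin_exponent /= ma trig_int_sin1.
  - by exists a.+2; rewrite /cos_exponent /= ma trig_int_cos1.
apply/eqP; rewrite prodf_seq_eq0; apply/hasP; exists k.
  by rewrite mem_index_iota k1.
by rewrite k0 eqxx.
Qed.

End MonomialIntegrals.

(** * Infinitesimal rotations of polynomials *)

Section RotationFields.
Variables (R : realType) (n : nat).
Local Notation poly := (mpoly.mpoly n R[i]).
Local Notation Xi b := (mpoly.mpolyX R[i] (mpoly.mnm1 b)).
Local Notation D := mpoly.mderiv.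
Implicit Types (x u v : 'I_n -> R) (p q : poly) (A : 'I_n -> 'I_n -> R).

Definition ev x p : R[i] := mpoly.meval (fun k => (x k)%:C%C) p.

Definition dirder u x p : R[i] := \sum_k (u k)%:C%C * ev x (D k p).

Definition laplacian p : poly := \sum_k D k (D k p).

Definition antisym A := forall a b, A a b = - A b a.

Definition act A x : 'I_n -> R := fun a => \sum_b A a b * x b.

(** The derivation along the linear vector field [act A]; for antisymmetric [A] it is an
    infinitesimal rotation. *)
Definition infrot A p : poly :=
  \sum_a \sum_b (A a b)%:C%C *: (Xi b * D a p).

Lemma mderivXU k b : D k (Xi b) = ((k == b)%:R : poly).
Proof.
rewrite mpoly.mderivX mpoly.mnm1E eq_sym.
case: eqP => [->|_]; rewrite ?scale0r// scale1r.
rewrite (_ : mpoly.mnm_sub _ _ = mpoly.mnm0) ?mpoly.mpolyX0//.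
by apply/mpoly.mnmP => i; rewrite mpoly.mnmBE mpoly.mnm0E subnn.
Qed.

Lemma evD x p q : ev x (p + q) = ev x p + ev x q.
Proof. exact: mpoly.mevalD. Qed.

Lemma evM x p q : ev x (p * q) = ev x p * ev x q.
Proof. exact: mpoly.mevalM. Qed.

Lemma evZ x c p : ev x (c *: p) = c * ev x p.
Proof. exact: mpoly.mevalZ. Qed.

Lemma ev0 x : ev x 0 = 0.
Proof. exact: mpoly.meval0. Qed.

Lemma evX x b : ev x (Xi b) = (x b)%:C%C.
Proof. exact: mpoly.mevalXU. Qed.

Lemma ev_sum x (I : Type) (r : seq I) (P : pred I) (F : I -> poly) :
  ev x (\sum_(i <- r | P i) F i) = \sum_(i <- r | P i) ev x (F i).
Proof. exact: raddf_sum. Qed.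

Lemma mderiv_sum k (I : Type) (r : seq I) (P : pred I) (F : I -> poly) :
  D k (\sum_(i <- r | P i) F i) = \sum_(i <- r | P i) D k (F i).
Proof. exact: (raddf_sum (D k)). Qed.

Lemma mderiv2_sum k (I : Type) (r : seq I) (P : pred I) (F : I -> poly) :
  D k (D k (\sum_(i <- r | P i) F i)) = \sum_(i <- r | P i) D k (D k (F i)).
Proof. by rewrite -mderiv_sum; congr (D k _); exact: mderiv_sum. Qed.

Lemma dirder_sum u x (I : Type) (r : seq I) (P : pred I) (F : I -> poly) :
  dirder u x (\sum_(i <- r | P i) F i) = \sum_(i <- r | P i) dirder u x (F i).
Proof.
rewrite /dirder exchange_big; apply: eq_bigr => k _ /=.
by rewrite mderiv_sum ev_sum mulr_sumr.
Qed.

Lemma dirderD u x p q : dirder u x (p + q) = dirder u x p + dirder u x q.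
Proof.
rewrite /dirder -big_split; apply: eq_bigr => k _ /=.
by rewrite mpoly.mderivD evD mulrDr.
Qed.

Lemma dirderZ u x c p : dirder u x (c *: p) = c * dirder u x p.
Proof.
rewrite /dirder mulr_sumr; apply: eq_bigr => k _.
by rewrite mpoly.mderivZ evZ mulrCA.
Qed.

Lemma dirderM u x p q :
  dirder u x (p * q) = dirder u x p * ev x q + ev x p * dirder u x q.
Proof.
rewrite /dirder mulr_suml mulr_sumr -big_split; apply: eq_bigr => k _ /=.
by rewrite mpoly.mderivM evD !evM; ring.
Qed.

Lemma dirderX u x b : dirder u x (Xi b) = (u b)%:C%C.
Proof.
rewrite /dirder (bigD1 b)//= mderivXU eqxx [ev x _]mpoly.meval1 mulr1.
rewrite big1 ?addr0// => k kb.
by rewrite mderivXU (negbTE kb) ev0 mulr0.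
Qed.

Lemma dirder_scale r u x p :
  dirder (fun k => r * u k) x p = r%:C%C * dirder u x p.
Proof.
rewrite /dirder mulr_sumr; apply: eq_bigr => k _.
by rewrite rmorphM mulrA.
Qed.

Lemma dirder_add u v x p :
  dirder (fun k => u k + v k) x p = dirder u x p + dirder v x p.
Proof.
rewrite /dirder -big_split; apply: eq_bigr => k _ /=.
by rewrite rmorphD mulrDl.
Qed.

Lemma ev_infrot A x p : ev x (infrot A p) = dirder (act A x) x p.
Proof.
rewrite /infrot /dirder ev_sum; apply: eq_bigr => a _.
rewrite ev_sum /act rmorph_sum mulr_suml; apply: eq_bigr => b _ /=.
by rewrite evZ evM evX rmorphM mulrA.
Qed.

(** Product rule: the first term differentiates the coefficients of the field, the second is a
    Hessian term, which disappears at points where the field vanishes. *)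
Lemma dirder_infrot A u x p :
  dirder u x (infrot A p) =
  dirder (act A u) x p + \sum_a (act A x a)%:C%C * dirder u x (D a p).
Proof.
rewrite /infrot dirder_sum {2}/dirder -big_split; apply: eq_bigr => a _ /=.
rewrite dirder_sum /act !rmorph_sum !mulr_suml -big_split; apply: eq_bigr => b _ /=.
by rewrite dirderZ dirderM dirderX evX !rmorphM /=; ring.
Qed.

Lemma infrot_is_linear A : linear (infrot A).
Proof.
move=> c p q; rewrite /infrot scaler_sumr -big_split; apply: eq_bigr => a _ /=.
rewrite scaler_sumr -big_split; apply: eq_bigr => b _ /=.
rewrite mpoly.mderivD mpoly.mderivZ mulrDr scalerDr; congr (_ + _).
by rewrite -scalerAr !scalerA mulrC.
Qed.

HB.instance Definition _ A :=
  GRing.isLinear.Build R[i] poly poly _ (infrot A) (infrot_is_linear A).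

Lemma infrot_sum A (I : Type) (r : seq I) (P : pred I) (F : I -> poly) :
  infrot A (\sum_(i <- r | P i) F i) = \sum_(i <- r | P i) infrot A (F i).
Proof. exact: (raddf_sum (infrot A)). Qed.

Lemma infrot0 A : infrot A 0 = 0.
Proof. exact: (raddf0 (infrot A)). Qed.

Lemma infrotZ A c p : infrot A (c *: p) = c *: infrot A p.
Proof. exact: (linearZ_LR (infrot A)). Qed.

Lemma infrotM A p q : infrot A (p * q) = infrot A p * q + p * infrot A q.
Proof.
rewrite /infrot mulr_suml mulr_sumr -big_split; apply: eq_bigr => a _ /=.
rewrite mulr_suml mulr_sumr -big_split; apply: eq_bigr => b _ /=.
rewrite mpoly.mderivM mulrDr scalerDr -!scalerAl -!scalerAr.
by congr (_ *: _ + _ *: _); ring.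
Qed.

(** Exchanging the indices shows that the sum equals its opposite. A general module serves both
    polynomials and scalars. *)
Lemma antisym_sum0 (V : lmodType R[i]) A (S : 'I_n -> 'I_n -> V) : antisym A ->
  (forall a b, S a b = S b a) ->
  \sum_a \sum_b (A a b)%:C%C *: S a b = 0.
Proof.
move=> skA symS; set T := (X in X = 0).
have TN : T = - T.
  rewrite {1}/T exchange_big /= -sumrN; apply: eq_bigr => a _.
  rewrite -sumrN; apply: eq_bigr => b _.
  by rewrite skA symS rmorphN scaleNr.
have : (2%:R : R[i]) *: T == 0 by rewrite scaler_nat mulr2n {2}TN subrr.
by rewrite scaler_eq0 pnatr_eq0 /= => /eqP.
Qed.

(** The commutator of the two operators is twice the contraction of [A] with the symmetric matrix of
    second derivatives, hence zero. *)
Lemma laplacian_infrot A p : antisym A -> laplacian (infrot A p) = infrot A (laplacian p).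
Proof.
move=> skA.
have DDX b q : \sum_k D k (D k (Xi b * q)) = 2%:R *: D b q + Xi b * laplacian q.
  have E k : D k (D k (Xi b * q)) =
      2%:R *: ((k == b)%:R * D k q) + Xi b * D k (D k q).
    rewrite !(mpoly.mderivM, mpoly.mderivD) mderivXU.
    have -> : D k ((k == b)%:R : poly) = 0.
      by case: (k == b); rewrite ?mpoly.mderiv0// -mpoly.mpolyC1 mpoly.mderivC.
    by rewrite mul0r add0r addrA scaler_nat mulr2n.
  rewrite (eq_bigr _ (fun k _ => E k)) big_split /= -mulr_sumr; congr (_ + _).
  rewrite -scaler_sumr (bigD1 b)//= eqxx mul1r big1 ?addr0// => k kb.
  by rewrite (negbTE kb) mul0r.
have E : laplacian (infrot A p) = \sum_a \sum_b (A a b)%:C%C *: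
    (2%:R *: D b (D a p) + Xi b * laplacian (D a p)).
  have DDrot k : D k (D k (infrot A p)) =
      \sum_a \sum_b (A a b)%:C%C *: D k (D k (Xi b * D a p)).
    rewrite /infrot mderiv2_sum; apply: eq_bigr => a _.
    by rewrite mderiv2_sum; apply: eq_bigr => b _; rewrite !mpoly.mderivZ.
  rewrite /laplacian (eq_bigr _ (fun k _ => DDrot k)).
  rewrite exchange_big /=; apply: eq_bigr => a _.
  rewrite exchange_big /=; apply: eq_bigr => b _.
  by rewrite -scaler_sumr DDX.
have lapD a : laplacian (D a p) = D a (laplacian p).
  rewrite /laplacian mderiv_sum; apply: eq_bigr => k _ /=.
  by rewrite (mpoly.mderiv_comm k a) (mpoly.mderiv_comm k a).
rewrite E; under eq_bigr => a _.
  under eq_bigr => b _ do rewrite scalerDr lapD.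
  rewrite big_split /=; over.
rewrite big_split /= antisym_sum0 ?add0r// => a b.
by rewrite mpoly.mderiv_comm.
Qed.

Local Notation homog l :=
  (mpoly.ishomog1 l (mpoly.Measure.clone n (@mpoly.mdeg n) _)).

Lemma mderivE a p : D a p = \sum_(m <- mpoly.msupp p)
  ((m a)%:R * mpoly.mcoeff m p) *: mpoly.mpolyX R[i] (mpoly.mnm_sub m (mpoly.mnm1 a)).
Proof. by []. Qed.

Lemma subU1K (m : mpoly.multinom n) a : m a != 0%N ->
  mpoly.mnm_add (mpoly.mnm1 a) (mpoly.mnm_sub m (mpoly.mnm1 a)) = m.
Proof.
move=> ma; apply/mpoly.mnmP => i.
rewrite mpoly.mnmDE mpoly.mnmBE mpoly.mnm1E subnKC//.
by case: eqP => // <-; rewrite lt0n.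
Qed.

Lemma homog_infrot l A p : p \is homog l -> infrot A p \is homog l.
Proof.
move=> /mpoly.dhomogP hp; rewrite /infrot.
apply: rpred_sum => a _; apply: rpred_sum => b _; apply: mpoly.dhomogZ.
rewrite mderivE mulr_sumr big_seq; apply: rpred_sum => m mp.
rewrite -scalerAr -mpoly.mpolyXD.
(* When [m a] is zero the truncated exponent is wrong, but its coefficient vanishes. *)
have [->|ma] := eqVneq (m a) 0%N; first by rewrite mul0r scale0r rpred0.
apply: mpoly.dhomogZ; rewrite mpoly.dhomogX -(hp _ mp) /=.
by apply/eqP; rewrite -{2}(subU1K ma) !mpoly.mdegD !mpoly.mdeg1.
Qed.

Lemma euler l p : p \is homog l -> \sum_k Xi k * D k p = l%:R *: p.
Proof.
move=> /mpoly.dhomogP hp.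
rewrite [in RHS](mpoly.mpolyE p) scaler_sumr.
have E k : Xi k * D k p = \sum_(m <- mpoly.msupp p)
    ((m k)%:R * mpoly.mcoeff m p) *: mpoly.mpolyX R[i] m.
  rewrite mderivE mulr_sumr; apply: eq_bigr => m _.
  rewrite -scalerAr -mpoly.mpolyXD.
  have [->|ma] := eqVneq (m k) 0%N; first by rewrite mul0r !scale0r.
  by rewrite subU1K.
rewrite (eq_bigr _ (fun k _ => E k)) exchange_big /= !big_seq.
apply: eq_bigr => m mp; rewrite -scaler_suml -mulr_suml -natr_sum scalerA.
by congr (_%:R * _ *: _); rewrite -(hp _ mp) /= mpoly.mdegE.
Qed.

Lemma euler1 l p x : p \is homog l -> dirder x x p = l%:R * ev x p.
Proof.
move=> /euler /(congr1 (ev x)); rewrite evZ ev_sum => <-.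
by apply: eq_bigr => k _; rewrite evM evX.
Qed.

(** Euler's identity differentiated once more in the radial direction. *)
Lemma euler2 l p x : p \is homog l ->
  \sum_a (x a)%:C%C * dirder x x (D a p) = (l%:R ^+ 2 - l%:R) * ev x p.
Proof.
move=> hp; have /(congr1 (dirder x x)) := euler hp.
rewrite dirderZ (euler1 _ hp) dirder_sum.
under eq_bigr => k _ do rewrite dirderM dirderX evX.
rewrite big_split /= -/(dirder x x p) (euler1 _ hp) => H.
by rewrite mulrBl expr2 -mulrA -H; ring.
Qed.

End RotationFields.

(** * Integration of polynomials over the sphere *)

Section SphereFunctional.
Variables (R : realType) (d : nat).
Hypothesis d_gt0 : (0 < d)%N.
Local Notation poly := (mpoly.mpoly d.+1 R[i]).
Local Notation Xi b := (mpoly.mpolyX R[i] (mpoly.mnm1 b)).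
Local Notation D := mpoly.mderiv.
Implicit Types (p q : poly) (A : 'I_d.+1 -> 'I_d.+1 -> R).

Definition mnm_nat (m : mpoly.multinom d.+1) : nat -> nat := fun i => m (inord i).

Definition moment (m : mpoly.multinom d.+1) : R := sphere_moment R d (mnm_nat m).

Lemma eq_sphere_moment (f g : nat -> nat) :
  (forall i, (i <= d)%N -> f i = g i) -> sphere_moment R d f = sphere_moment R d g.
Proof.
move=> fg; rewrite /sphere_moment !big_nat; apply: eq_bigr => k /andP[k1 kd].
rewrite /cos_exponent /sin_exponent.
congr trig_int; first by case: ifP => _; apply: fg.
case: ifP => _; first exact: fg.
by congr (_ + _)%N; rewrite !big_nat; apply: eq_bigr => i /andP[_ ik]; apply: fg; lia.
Qed.

(** If both exponents are positive, both sides are the same multiple of the moment of [m] lowered at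
    [a] and at [b]. Otherwise both vanish, one exponent being raised from zero to one. *)
Lemma moment_swap (m : mpoly.multinom d.+1) (a b : 'I_d.+1) :
  (m a)%:R * moment (mpoly.mnm_add (mpoly.mnm1 b) (mpoly.mnm_sub m (mpoly.mnm1 a))) =
  (m b)%:R * moment (mpoly.mnm_add (mpoly.mnm1 a) (mpoly.mnm_sub m (mpoly.mnm1 b))).
Proof.
have [->//|ab] := eqVneq a b.
have odd0 (i j : 'I_d.+1) : i != j -> m i = 0%N ->
    moment (mpoly.mnm_add (mpoly.mnm1 i) (mpoly.mnm_sub m (mpoly.mnm1 j))) = 0.
  move=> ij mi; apply: (@sphere_moment_odd _ _ _ i) => //; first by rewrite -ltnS.
  rewrite /mnm_nat inord_val mpoly.mnmDE mpoly.mnmBE !mpoly.mnm1E eqxx mi.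
  by rewrite eq_sym (negbTE ij).
have [ma|ma] := eqVneq (m a) 0%N; first by rewrite ma mul0r odd0// mulr0.
have [mb|mb] := eqVneq (m b) 0%N.
  by rewrite mb mul0r odd0 ?mulr0// eq_sym.
pose mu := mpoly.mnm_sub (mpoly.mnm_sub m (mpoly.mnm1 a)) (mpoly.mnm1 b).
pose c := (\sum_(0 <= i < d.+1) mnm_nat mu i + d.+1)%N.
have E (i j : 'I_d.+1) : i != j -> m i != 0%N -> m j != 0%N ->
    mu = mpoly.mnm_sub (mpoly.mnm_sub m (mpoly.mnm1 i)) (mpoly.mnm1 j) ->
    c%:R * moment (mpoly.mnm_add (mpoly.mnm1 j) (mpoly.mnm_sub m (mpoly.mnm1 i))) =
    (m j)%:R * moment mu.
  move=> ij mi mj muE.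
  have -> : moment (mpoly.mnm_add (mpoly.mnm1 j) (mpoly.mnm_sub m (mpoly.mnm1 i))) =
      sphere_moment R d (mnm_incr (mnm_nat mu) j).
    apply: eq_sphere_moment => k kd.
    rewrite /mnm_incr /mnm_nat muE !mpoly.mnmDE !mpoly.mnmBE !mpoly.mnm1E.
    have -> : (k == j) = (j == inord k).
      by rewrite eq_sym -val_eqE /= inordK.
    case: eqP => [<-|_]; last by lia.
    by rewrite (negbTE ij); lia.
  rewrite sphere_moment_incr//; last by rewrite -ltnS.
  congr (_%:R * _).
  rewrite /mnm_nat inord_val muE !mpoly.mnmBE !mpoly.mnm1E eqxx (negbTE ij); lia.
have c0 : (c%:R : R) != 0 by rewrite pnatr_eq0 /c addnS.
have Eba : c%:R * moment (mpoly.mnm_add (mpoly.mnm1 a) (mpoly.mnm_sub m (mpoly.mnm1 b))) =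
    (m a)%:R * moment mu.
  apply: E => //; first by rewrite eq_sym.
  by apply/mpoly.mnmP => i; rewrite /mu !mpoly.mnmBE; lia.
have := E a b ab ma mb erefl; move: Eba.
move: (moment mu) (moment (mpoly.mnm_add _ _)) (moment (mpoly.mnm_add _ _)) => z x y yE xE.
apply: (mulfI c0); transitivity ((m a)%:R * (c%:R * x)); first by ring.
by transitivity ((m b)%:R * (c%:R * y)); [rewrite xE yE; ring|ring].
Qed.

(** The integral over the sphere, defined on coefficients so that linearity is algebraic;
    [sphere_cint_poly] identifies it with the analytic integral. *)
Definition sphere_fun p : R[i] :=
  \sum_(m <- mpoly.msupp p) mpoly.mcoeff m p * (moment m)%:C%C.

(** Polynomials with different supports can thus be summed over one common list of exponents. *)
Lemma sphere_fun_wide p (s : seq (mpoly.multinom d.+1)) : uniq s ->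
  {subset mpoly.msupp p <= s} ->
  sphere_fun p = \sum_(m <- s) mpoly.mcoeff m p * (moment m)%:C%C.
Proof.
move=> us ps; rewrite (bigID (mem (mpoly.msupp p))) /= [X in _ + X]big1 ?addr0.
  rewrite -big_filter; apply: perm_big; apply: uniq_perm.
  - exact: mpoly.msupp_uniq.
  - exact: filter_uniq.
  - by move=> m; rewrite mem_filter; case: (boolP (m \in _)) => //= /ps ->.
by move=> m /mpoly.memN_msupp_eq0 ->; rewrite mul0r.
Qed.

Lemma sphere_fun_is_linear : linear_for *%R sphere_fun.
Proof.
move=> c p q; pose s := undup (mpoly.msupp p ++ mpoly.msupp q).
have us : uniq s by exact: undup_uniq.
have sp : {subset mpoly.msupp p <= s}.
  by move=> m mp; rewrite mem_undup mem_cat mp.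
have sq : {subset mpoly.msupp q <= s}.
  by move=> m mq; rewrite mem_undup mem_cat mq orbT.
rewrite (sphere_fun_wide us sp) (sphere_fun_wide us sq).
rewrite (@sphere_fun_wide (c *: p + q) s)//; last first.
  move=> m /mpoly.msuppD_le; rewrite mem_undup !mem_cat.
  by case/orP => [/mpoly.msuppZ_le ->//|->]; rewrite orbT.
rewrite mulr_sumr -big_split; apply: eq_bigr => m _ /=.
by rewrite mpoly.mcoeffD mpoly.mcoeffZ; ring.
Qed.

HB.instance Definition _ :=
  GRing.isLinear.Build R[i] poly R[i] *%R sphere_fun sphere_fun_is_linear.

Lemma sphere_funX m : sphere_fun (mpoly.mpolyX R[i] m) = (moment m)%:C%C.
Proof. by rewrite /sphere_fun mpoly.msuppX big_seq1 mpoly.mcoeffX eqxx mul1r. Qed.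

Lemma sphere_funZ c p : sphere_fun (c *: p) = c * sphere_fun p.
Proof. exact: (linearZ_LR sphere_fun). Qed.

Lemma sphere_fun_sum (I : Type) (r : seq I) (P : pred I) (F : I -> poly) :
  sphere_fun (\sum_(i <- r | P i) F i) = \sum_(i <- r | P i) sphere_fun (F i).
Proof. exact: (raddf_sum sphere_fun). Qed.

(** Infinitesimal rotation invariance of the measure. On a monomial the value is a contraction of
    [A] with a matrix of moments, symmetric by [moment_swap]. *)
Lemma sphere_fun_infrot A p : antisym A -> sphere_fun (infrot A p) = 0.
Proof.
move=> skA; rewrite (mpoly.mpolyE p) infrot_sum sphere_fun_sum.
rewrite big1// => m _; rewrite infrotZ sphere_funZ.
suff -> : sphere_fun (infrot A (mpoly.mpolyX R[i] m)) = 0 by rewrite mulr0.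
rewrite /infrot sphere_fun_sum.
(* Scalars are viewed as a module over themselves so that [antisym_sum0] applies. *)
pose S (a b : 'I_d.+1) : R[i]^o := ((m a)%:R *
  moment (mpoly.mnm_add (mpoly.mnm1 b) (mpoly.mnm_sub m (mpoly.mnm1 a))))%:C%C.
have symS a b : S a b = S b a by rewrite /S moment_swap.
have SE a b : sphere_fun (Xi b * D a (mpoly.mpolyX R[i] m)) = S a b.
  rewrite mpoly.mderivX -scalerAr sphere_funZ -mpoly.mpolyXD sphere_funX.
  by rewrite /S rmorphM /= rmorph_nat.
clearbody S; rewrite -[RHS](antisym_sum0 skA symS).
apply: eq_bigr => a _; rewrite sphere_fun_sum; apply: eq_bigr => b _.
by rewrite sphere_funZ SE.
Qed.

Lemma ev_monomials x p :
  ev x p = \sum_(m <- mpoly.msupp p) mpoly.mcoeff m p *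
    (\prod_(0 <= k < d.+1) x (inord k) ^+ mnm_nat m k)%:C%C.
Proof.
rewrite /ev mpoly.mevalE; apply: eq_bigr => m _; congr (_ * _).
rewrite big_mkord rmorph_prod; apply: eq_bigr => k _ /=.
by rewrite /mnm_nat inord_val rmorphXn.
Qed.

Lemma Re_sum (I : Type) (r : seq I) (F : I -> R[i]) :
  complex.Re (\sum_(i <- r) F i) = \sum_(i <- r) complex.Re (F i).
Proof.
elim: r => [|i r IH]; rewrite ?big_nil// !big_cons -IH.
by case: (F i); case: (\sum_(_ <- _) _).
Qed.

Lemma Im_sum (I : Type) (r : seq I) (F : I -> R[i]) :
  complex.Im (\sum_(i <- r) F i) = \sum_(i <- r) complex.Im (F i).
Proof.
elim: r => [|i r IH]; rewrite ?big_nil// !big_cons -IH.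
by case: (F i); case: (\sum_(_ <- _) _).
Qed.

Lemma Re_mulr (z : R[i]) (r : R) : complex.Re (z * r%:C%C) = complex.Re z * r.
Proof. by case: z => a b; simpc. Qed.

Lemma Im_mulr (z : R[i]) (r : R) : complex.Im (z * r%:C%C) = complex.Im z * r.
Proof. by case: z => a b; simpc. Qed.

Lemma sphere_cint_poly p :
  sphere_cint d (fun th => ev (@xcoord R d th) p) = sphere_fun p.
Proof.
have E th m : \prod_(0 <= k < d.+1) @xcoord R d th (inord k) ^+ mnm_nat m k =
    \prod_(0 <= k < d.+1) xnat d th k ^+ mnm_nat m k.
  by rewrite !big_nat; apply: eq_bigr => k /andP[_ kd]; rewrite xcoordE inordK.
rewrite /sphere_cint.
have -> : (fun th => complex.Re (ev (@xcoord R d th) p)) = (fun th =>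
    \sum_(m <- mpoly.msupp p) complex.Re (mpoly.mcoeff m p) *
      \prod_(0 <= k < d.+1) xnat d th k ^+ mnm_nat m k).
  apply/funext => th; rewrite ev_monomials Re_sum; apply: eq_bigr => m _.
  by rewrite Re_mulr E.
have -> : (fun th => complex.Im (ev (@xcoord R d th) p)) = (fun th =>
    \sum_(m <- mpoly.msupp p) complex.Im (mpoly.mcoeff m p) *
      \prod_(0 <= k < d.+1) xnat d th k ^+ mnm_nat m k).
  apply/funext => th; rewrite ev_monomials Im_sum; apply: eq_bigr => m _.
  by rewrite Im_mulr E.
rewrite !sphere_int_monomials// /sphere_fun.
apply/eqP; rewrite eq_complex /= Re_sum Im_sum; apply/andP; split; apply/eqP.
  by apply: eq_bigr => m _; rewrite Re_mulr.
by apply: eq_bigr => m _; rewrite Im_mulr.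
Qed.

End SphereFunctional.

(** * Curves on the sphere *)

Section Curves.
Variables (R : realType) (n : nat).
Local Notation poly := (mpoly.mpoly n R[i]).
Local Notation Xi b := (mpoly.mpolyX R[i] (mpoly.mnm1 b)).

(** Real and imaginary parts are differentiated separately, as in [dtheta]. *)
Definition cderive (f : R -> R[i]) (t : R) (z : R[i]) : Prop :=
  is_derive t 1 (fun s => complex.Re (f s)) (complex.Re z) /\
  is_derive t 1 (fun s => complex.Im (f s)) (complex.Im z).

Lemma cderive_cst c (t : R) : cderive (fun=> c) t 0.
Proof. by split; exact: is_derive_cst. Qed.

Lemma cderive_real (f : R -> R) (t a : R) : is_derive t 1 f a ->
  cderive (fun s => (f s)%:C%C) t a%:C%C.
Proof. by move=> fa; split => //=; exact: is_derive_cst. Qed.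

Lemma cderiveD f g (t : R) a b : cderive f t a -> cderive g t b ->
  cderive (fun s => f s + g s) t (a + b).
Proof.
move=> [fr fi] [gr gi]; split.
  have -> : (fun s => complex.Re (f s + g s)) =
      (fun s => complex.Re (f s)) + (fun s => complex.Re (g s)).
    by apply/funext => s /=; rewrite fctE; case: (f s); case: (g s).
  by apply: is_derive_eq; case: a {fr fi} => ? ?; case: b {gr gi}.
have -> : (fun s => complex.Im (f s + g s)) =
    (fun s => complex.Im (f s)) + (fun s => complex.Im (g s)).
  by apply/funext => s /=; rewrite fctE; case: (f s); case: (g s).
by apply: is_derive_eq; case: a {fr fi} => ? ?; case: b {gr gi}.
Qed.

Lemma cderiveM f g (t : R) a b : cderive f t a -> cderive g t b ->
  cderive (fun s => f s * g s) t (a * g t + f t * b).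
Proof.
move=> [fr fi] [gr gi]; split.
  have -> : (fun s => complex.Re (f s * g s)) =
      (fun s => complex.Re (f s)) * (fun s => complex.Re (g s)) -
      (fun s => complex.Im (f s)) * (fun s => complex.Im (g s)).
    by apply/funext => s /=; rewrite !fctE; case: (f s); case: (g s).
  apply: is_derive_eq; case: a {fr fi} => ? ?; case: b {gr gi} => ? ?.
  by rewrite /GRing.scale /=; case: (f t) => ? ?; case: (g t) => ? ? /=; ring.
have -> : (fun s => complex.Im (f s * g s)) =
    (fun s => complex.Re (f s)) * (fun s => complex.Im (g s)) +
    (fun s => complex.Im (f s)) * (fun s => complex.Re (g s)).
  by apply/funext => s /=; rewrite !fctE; case: (f s); case: (g s).
apply: (is_derive_eq (is_deriveD (is_deriveM fr gi) (is_deriveM fi gr))).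
case: a {fr fi} => ? ?; case: b {gr gi} => ? ?.
by rewrite /GRing.scale /=; case: (f t) => ? ?; case: (g t) => ? ? /=; ring.
Qed.

(** Chain rule. The polynomials satisfying it contain the constants and variables and are closed
    under the ring operations. *)
Lemma cderive_ev (c : R -> 'I_n -> R) (t : R) (v : 'I_n -> R) (p : poly) :
  (forall k, is_derive t 1 (fun s => c s k) (v k)) ->
  cderive (fun s => ev (c s) p) t (dirder v (c t) p).
Proof.
move=> cv.
pose Q p := cderive (fun s => ev (c s) p) t (dirder v (c t) p).
have Q0 : Q 0.
  rewrite /Q; have -> : (fun s => ev (c s) (0 : poly)) = fun=> 0.
    by apply/funext => s; rewrite ev0.
  rewrite [dirder _ _ _]big1; first exact: cderive_cst.
  by move=> k _; rewrite mpoly.mderiv0 ev0 mulr0.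
have Q1 : Q 1.
  rewrite /Q; have -> : (fun s => ev (c s) (1 : poly)) = fun=> 1.
    by apply/funext => s; rewrite /ev mpoly.meval1.
  rewrite [dirder _ _ _]big1; first exact: cderive_cst.
  by move=> k _; rewrite -mpoly.mpolyC1 mpoly.mderivC ev0 mulr0.
have QX b : Q (Xi b).
  rewrite /Q dirderX.
  have -> : (fun s => ev (c s) (Xi b)) = fun s => (c s b)%:C%C.
    by apply/funext => s; rewrite evX.
  exact: cderive_real.
have QD p1 p2 : Q p1 -> Q p2 -> Q (p1 + p2).
  rewrite /Q; have -> : (fun s => ev (c s) (p1 + p2)) =
      fun s => ev (c s) p1 + ev (c s) p2 by apply/funext => s; rewrite evD.
  rewrite dirderD.
  exact: cderiveD.
have QM p1 p2 : Q p1 -> Q p2 -> Q (p1 * p2).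
  rewrite /Q; have -> : (fun s => ev (c s) (p1 * p2)) =
      fun s => ev (c s) p1 * ev (c s) p2 by apply/funext => s; rewrite evM.
  by rewrite dirderM; exact: cderiveM.
have QZ a p1 : Q p1 -> Q (a *: p1).
  rewrite /Q; have -> : (fun s => ev (c s) (a *: p1)) =
      fun s => a * ev (c s) p1 by apply/funext => s; rewrite evZ.
  rewrite dirderZ -[a * dirder _ _ _]add0r -[0](mul0r (ev (c t) p1)).
  by apply: cderiveM; exact: cderive_cst.
suff: forall r, Q r by move=> Qr; exact: (Qr p).
clearbody Q => r.
rewrite (mpoly.mpolyE r).
apply: (big_ind Q) => // m _; apply: QZ.
rewrite mpoly.mpolyXE_id; apply: (big_ind Q) => // i _.
by elim: (m i) => [|k IH]; rewrite ?expr0// exprS; exact: QM.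
Qed.

Lemma cderive_unique f (t : R) a b : cderive f t a -> cderive f t b -> a = b.
Proof.
move=> [ar ai] [br bi]; apply/eqP; rewrite eq_complex.
by rewrite -(@derive_val _ _ _ _ _ _ _ ar) -(@derive_val _ _ _ _ _ _ _ br)
  -(@derive_val _ _ _ _ _ _ _ ai) -(@derive_val _ _ _ _ _ _ _ bi) !eqxx.
Qed.

End Curves.

(** * Tangent vectors and hyperspherical coordinates *)

Section SphereGeometry.
Variables (R : realType) (d : nat).
Local Notation poly := (mpoly.mpoly d.+1 R[i]).
Implicit Types (x u v : 'I_d.+1 -> R) (theta : nat -> R).

Definition dot u v : R := \sum_k u k * v k.

Lemma is_derive_trig (a b c t : R) :
  is_derive t 1 (fun s => a * cos s + b * sin s + c) (b * cos t - a * sin t).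
Proof.
have -> : (fun s => a * cos s + b * sin s + c) = a *: @cos R + b *: @sin R + cst c.
  by apply/funext.
apply: (is_derive_eq (is_deriveD (is_deriveD
  (is_deriveZ a (is_derive_cos t)) (is_deriveZ b (is_derive_sin t)))
  (is_derive_cst c t 1))).
by rewrite /GRing.scale /=; ring.
Qed.

(** For a unit tangent vector, [p] vanishes along the great circle through [x] in that direction;
    other vectors are zero or can be normalised. *)
Lemma dirder_tangent (p : poly) x u :
  (forall y, on_sphere y -> ev y p = 0) -> on_sphere x -> dot u x = 0 ->
  dirder u x p = 0.
Proof.
move=> p0 sx.
have unit_case v : dot v v = 1 -> dot v x = 0 -> dirder v x p = 0.
  move=> v1 vx; pose c (s : R) k := cos s * x k + sin s * v k.
  have c0 : c 0 = x by apply/funext => k; rewrite /c cos0 sin0 mul1r mul0r addr0.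
  have dc k : is_derive (0 : R) 1 (fun s => c s k) (v k).
    have := is_derive_trig (x k) (v k) 0 0; rewrite cos0 sin0 mulr1 mulr0 subr0.
    by rewrite /c; under eq_fun do rewrite addr0 mulrC [v k * _]mulrC.
  have := cderive_ev p dc; rewrite c0 => H; apply: (cderive_unique H).
  have -> : (fun s => ev (c s) p) = fun=> 0.
    apply/funext => s; apply: p0; rewrite /on_sphere.
    transitivity (cos s ^+ 2 * (\sum_k x k ^+ 2) + 2 * cos s * sin s * dot v x +
                  sin s ^+ 2 * dot v v).
      rewrite !mulr_sumr -!big_split; apply: eq_bigr => k _; rewrite /c /=; ring.
    by rewrite sx vx v1 !mulr1 mulr0 addr0 cos2Dsin2.
  exact: cderive_cst.
move=> ux; have u_ge0 : 0 <= dot u u by apply: sumr_ge0 => k _; rewrite -expr2 sqr_ge0.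
have [u0|u0] := eqVneq (dot u u) 0.
  rewrite /dirder big1// => k _.
  have /eqP := u0; rewrite psumr_eq0 => [/allP/(_ k)|i _]; last by rewrite -expr2 sqr_ge0.
  by rewrite mem_index_enum /= mulf_eq0 orbb => /(_ isT)/eqP ->; rewrite mul0r.
pose r := Num.sqrt (dot u u).
have r0 : r != 0 by rewrite sqrtr_eq0 -ltNge lt_def u0.
have -> : u = fun k => r * (r^-1 * u k) by apply/funext => k; rewrite mulVKf.
rewrite dirder_scale unit_case ?mulr0//.
  transitivity (r ^- 2 * dot u u).
    by rewrite /dot mulr_sumr; apply: eq_bigr => k _; field.
  by rewrite -[dot u u](sqr_sqrtr u_ge0) mulVf// expf_neq0.
transitivity (r^-1 * dot u x); last by rewrite ux mulr0.
by rewrite /dot mulr_sumr; apply: eq_bigr => k _; rewrite mulrA.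
Qed.

Lemma eta_ltn j theta : (j < d)%N ->
  eta d j theta = sin (theta j.+1) * eta d j.+1 theta.
Proof. by move=> jd; rewrite /eta big_ltn. Qed.

Lemma xnat_gt1 theta k : (1 < k)%N -> xnat d theta k = eta d k theta * cos (theta k).
Proof. by case: k => [|[|k]]. Qed.

(** The partial sums telescope through the Pythagorean identity; [j = d] gives the equation of the
    sphere. *)
Lemma sum_xnat_sqr theta j : (0 < j <= d)%N ->
  \sum_(0 <= k < j.+1) xnat d theta k ^+ 2 = eta d j theta ^+ 2.
Proof.
case: j => // j /=; elim: j => [|j IH] jd.
  rewrite big_nat_recr//= big_nat1 /xnat /= -/(eta d 1 theta).
  by rewrite !exprMn -mulrDr cos2Dsin2 mulr1.
rewrite big_nat_recr//= IH ?(ltnW jd)// xnat_gt1// eta_ltn//.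
by rewrite !exprMn mulrC -mulrDr addrC cos2Dsin2 mulr1.
Qed.

Lemma xcoord_on_sphere theta : (0 < d)%N -> on_sphere (@xcoord R d theta).
Proof.
move=> d0; rewrite /on_sphere -(big_mkord xpredT (fun k => xnat d theta k ^+ 2)).
by rewrite sum_xnat_sqr ?d0//= /eta big_geq// expr1n.
Qed.

Lemma prod_sin_upd_out theta j s m : (j < m)%N ->
  \prod_(m <= i < d.+1) sin (upd theta j s i) = \prod_(m <= i < d.+1) sin (theta i).
Proof.
move=> jm; rewrite !big_nat; apply: eq_bigr => i /andP[mi _].
by rewrite /upd gtn_eqF// (leq_trans jm).
Qed.

(** Setting the angle [j] to [pi / 2] makes its sine 1, which expresses the product without that
    factor. *)
Lemma prod_sin_upd_in theta j s m : (m <= j <= d)%N ->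
  \prod_(m <= i < d.+1) sin (upd theta j s i) =
  sin s * \prod_(m <= i < d.+1) sin (upd theta j (pi / 2) i).
Proof.
move=> /andP[mj jd].
rewrite !(@big_cat_nat _ _ _ j m d.+1)//=; try lia.
rewrite !(@big_ltn _ _ _ j)// !prod_sin_upd_out//.
rewrite {2 4}/upd eqxx sin_pihalf mul1r mulrCA; congr (_ * (_ * _)).
by rewrite !big_nat; apply: eq_bigr => i /andP[_ ij]; rewrite /upd ltn_eqF.
Qed.

Lemma xnat_upd_lt theta j s k : (k < j <= d)%N -> (1 < j)%N ->
  xnat d (upd theta j s) k = sin s * xnat d (upd theta j (pi / 2)) k.
Proof.
move=> /andP[kj jd] j1.
have kE i t : (i < j)%N -> upd theta j t i = theta i by move=> ij; rewrite /upd ltn_eqF.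
rewrite /xnat !kE//; case: ifP => _; first by rewrite prod_sin_upd_in ?j1// mulrA.
case: ifP => _; first by rewrite prod_sin_upd_in ?j1// mulrA.
by rewrite prod_sin_upd_in ?kj// mulrA.
Qed.

(** As the angle [j] varies, the point moves on a circle of radius [eta d j theta]: the coordinates
    below [j] are proportional to the sine, coordinate [j] to the cosine, and the others are
    fixed. *)
Lemma xcoord_derive theta j : (0 < j <= d)%N ->
  exists tau : 'I_d.+1 -> R,
  [/\ forall k, is_derive (theta j) 1 (fun s => xcoord (upd theta j s) k) (tau k),
      dot tau tau = eta d j theta ^+ 2 &
      dot tau (@xcoord R d theta) = 0].
Proof.
move=> /andP[j0 jd]; pose t := theta j.
have updE : upd theta j t = theta.
  by apply/funext => i; rewrite /upd /t; case: eqP => [->|].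
have etaE s : eta d j (upd theta j s) = eta d j theta by exact: prod_sin_upd_out.
have out s k : (j < k)%N -> xnat d (upd theta j s) k = xnat d theta k.
  move=> jk; rewrite !xnat_gt1 ?(leq_ltn_trans j0 jk)// /eta prod_sin_upd_out ?(ltnW jk)//.
    by rewrite /upd gtn_eqF.
  by rewrite ltnS ltnW.
have toord (f g : nat -> R) : \sum_(k < d.+1) f k * g k =
    \sum_(0 <= k < j.+1) f k * g k + \sum_(j.+1 <= k < d.+1) f k * g k.
  by rewrite -(big_mkord xpredT (fun k => f k * g k)) (@big_cat_nat _ _ _ j.+1).
(* The angle 1 is separate, because the roles of sine and cosine are interchanged in the first two
   coordinates. *)
have [j1|j1] := leqP j 1.
  have {j0}j1 : j = 1%N by lia.
  subst j.
  have x0 s : xnat d (upd theta 1 s) 0 = eta d 1 theta * cos s.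
    by rewrite -(etaE s) /xnat /= [upd theta 1 s 1%N]/upd eqxx.
  have x1 s : xnat d (upd theta 1 s) 1 = eta d 1 theta * sin s.
    by rewrite -(etaE s) /xnat /= [upd theta 1 s 1%N]/upd eqxx.
  pose tau k : R := if k == 0%N then - (eta d 1 theta * sin t)
    else if k == 1%N then eta d 1 theta * cos t else 0.
  have tau_out k : (1 < k)%N -> tau k = 0 by case: k => [|[|]].
  exists (fun k : 'I_d.+1 => tau k); split => /=.
  - move=> k; rewrite (_ : (fun s => _) = (fun s => xnat d (upd theta 1 s) k))//.
    case: (nat_of_ord k) => [|[|k']].
    + have := is_derive_trig (eta d 1 theta) 0 0 t; rewrite mul0r sub0r.
      congr is_derive; apply/funext => s.
      by rewrite x0 mul0r !addr0.
    + have := is_derive_trig 0 (eta d 1 theta) 0 t; rewrite mul0r subr0.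
      congr is_derive; apply/funext => s.
      by rewrite x1 mul0r addr0 add0r.
    + rewrite (_ : (fun s => _) = fun=> xnat d theta k'.+2); last first.
        by apply/funext => s; rewrite out.
      exact: is_derive_cst.
  - rewrite /dot toord big_nat_recr//= big_nat1 big_nat big1 ?addr0.
      rewrite /tau /=; have := cos2Dsin2 t; set e := eta _ _ _ => cs.
      by transitivity (e ^+ 2 * (cos t ^+ 2 + sin t ^+ 2)); [ring|rewrite cs mulr1].
    by move=> k /andP[k1 _]; rewrite tau_out// mul0r.
  - rewrite /dot (toord tau (xnat d theta)) big_nat_recr//= big_nat1 big_nat big1 ?addr0.
      by rewrite /tau /xnat /= -/(eta d 1 theta) -/t; ring.
    by move=> k /andP[k1 _]; rewrite tau_out// mul0r.
pose y := xnat d (upd theta j (pi / 2)).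
pose tau k : R := if (k < j)%N then cos t * y k
  else if k == j then - (eta d j theta * sin t) else 0.
have tau_out k : (j < k)%N -> tau k = 0.
  by move=> jk; rewrite /tau ltnNge (ltnW jk) /= gtn_eqF.
have tauj : tau j = - (eta d j theta * sin t) by rewrite /tau ltnn eqxx.
have xj s : xnat d (upd theta j s) j = eta d j theta * cos s.
  by rewrite xnat_gt1// etaE /upd eqxx.
have ylt s k : (k < j)%N -> xnat d (upd theta j s) k = sin s * y k.
  by move=> kj; rewrite /y xnat_upd_lt// kj.
have sumy : \sum_(0 <= k < j) y k ^+ 2 = eta d j theta ^+ 2.
  case: (j) j1 jd @y etaE {toord out tau tau_out tauj xj ylt updE j0 t} => // j' j1 jd y etaE.
  rewrite sum_xnat_sqr; last by rewrite -ltnS j1 ltnW.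
  by rewrite eta_ltn// etaE /upd eqxx sin_pihalf mul1r.
exists (fun k : 'I_d.+1 => tau k); split => /=.
- move=> k; rewrite (_ : (fun s => _) = (fun s => xnat d (upd theta j s) k))//.
  have [kj|kj|kj] := ltngtP k j.
  + have := is_derive_trig 0 (y k) 0 t; rewrite mul0r subr0 /tau kj mulrC.
    congr is_derive; apply/funext => s.
    by rewrite ylt// mul0r add0r addr0 mulrC.
  + rewrite tau_out// (_ : (fun s => _) = fun=> xnat d theta k); last first.
      by apply/funext => s; rewrite out.
    exact: is_derive_cst.
  + have := is_derive_trig (eta d j theta) 0 0 t; rewrite kj tauj mul0r sub0r.
    congr is_derive; apply/funext => s.
    by rewrite xj mul0r !addr0.
- rewrite /dot toord [X in _ + X]big_nat [X in _ + X]big1 ?addr0; last first.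
    by move=> k /andP[k1 _]; rewrite tau_out// mul0r.
  rewrite big_nat_recr//= tauj.
  have -> : \sum_(0 <= k < j) tau k * tau k = cos t ^+ 2 * eta d j theta ^+ 2.
    rewrite -sumy mulr_sumr !big_nat; apply: eq_bigr => k /andP[_ kj].
    by rewrite /tau kj; ring.
  have := cos2Dsin2 t; set e := eta _ _ _ => cs.
  by transitivity (e ^+ 2 * (cos t ^+ 2 + sin t ^+ 2)); [ring|rewrite cs mulr1].
- rewrite /dot (toord tau (xnat d theta)) [X in _ + X]big_nat [X in _ + X]big1 ?addr0; last first.
    by move=> k /andP[k1 _]; rewrite tau_out// mul0r.
  rewrite big_nat_recr//= tauj -updE xj updE.
  have -> : \sum_(0 <= k < j) tau k * xnat d theta k = cos t * sin t * eta d j theta ^+ 2.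
    rewrite -sumy mulr_sumr !big_nat; apply: eq_bigr => k /andP[_ kj].
    by rewrite /tau kj -{1}updE ylt//; ring.
  by ring.
Qed.

End SphereGeometry.

(** * Orthonormal bases of spherical harmonics *)

Lemma conjc_realM (R : realType) (r : R) (z : R[i]) :
  conjc (r%:C%C * z) = r%:C%C * conjc z.
Proof. by rewrite rmorphM; congr (_ * _); exact: conjc_real. Qed.

Lemma conjcD (R : realType) (z w : R[i]) : conjc (z + w) = conjc z + conjc w.
Proof. exact: rmorphD. Qed.

(** * Conjugation of coefficients, which at real points conjugates the values *)

Section ConjugatePolynomial.
Variables (R : realType) (n : nat).
Local Notation poly := (mpoly.mpoly n R[i]).
Implicit Types (p q : poly) (x u : 'I_n -> R).

Definition conjp p : poly := mpoly.map_mpoly (@conjc R) p.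

Lemma mderiv_conjp k p : mpoly.mderiv k (conjp p) = conjp (mpoly.mderiv k p).
Proof.
apply/mpoly.mpolyP => m.
rewrite mpoly.mcoeff_map_mpoly !mpoly.mcoeff_mderiv mpoly.mcoeff_map_mpoly.
by rewrite raddfMn.
Qed.

Lemma ev_conjp x p : ev x (conjp p) = conjc (ev x p).
Proof.
rewrite /conjp (mpoly.mpolyE p) rmorph_sum !ev_sum rmorph_sum.
apply: eq_bigr => m _ /=; rewrite mpoly.map_mpolyZ mpoly.map_mpolyX !evZ rmorphM.
congr (_ * _); rewrite /ev mpoly.mevalX rmorph_prod; apply: eq_bigr => k _ /=.
by rewrite rmorphXn /= oppr0.
Qed.

Lemma dirder_conjp u x p : dirder u x (conjp p) = conjc (dirder u x p).
Proof.
rewrite /dirder rmorph_sum; apply: eq_bigr => k _.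
by rewrite mderiv_conjp ev_conjp rmorphM /= oppr0.
Qed.

End ConjugatePolynomial.

(** * The standard Hermitian form and skew-Hermitian matrices *)

Section HermitianForm.
Variables (R : realType) (N : nat).
Implicit Types (U V : 'I_N -> R[i]) (c : 'I_N -> 'I_N -> R[i]).

Definition hform U V : R[i] := \sum_m U m * conjc (V m).

Definition skew_hermitian c := forall m n, c m n + conjc (c n m) = 0.

Definition mulv c U : 'I_N -> R[i] := fun m => \sum_n c m n * U n.

Lemma hform_skew c U V : skew_hermitian c ->
  hform (mulv c U) V = - hform U (mulv c V).
Proof.
move=> sc; apply/eqP; rewrite -addr_eq0; apply/eqP.
rewrite /hform /mulv.
under eq_bigr do rewrite mulr_suml.
under [X in _ + X]eq_bigr do rewrite rmorph_sum mulr_sumr.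
rewrite [X in _ + X]exchange_big -big_split big1// => m _ /=.
rewrite -big_split big1// => k _ /=.
rewrite rmorphM; transitivity ((c m k + conjc (c k m)) * U k * conjc (V m)); first by ring.
by rewrite sc !mul0r.
Qed.

End HermitianForm.

(** * Generators of plane rotations and tangential projections *)

Section Wedge.
Variables (R : realType) (n : nat).
Implicit Types (v w u : 'I_n.+1 -> R).

Definition wedge v w : 'I_n.+1 -> 'I_n.+1 -> R := fun a b => v a * w b - w a * v b.

Lemma antisym_wedge v w : antisym (wedge v w).
Proof. by move=> a b; rewrite /wedge; ring. Qed.

Lemma act_wedge v w u a : act (wedge v w) u a = v a * dot w u - w a * dot v u.
Proof.
rewrite /act /dot !mulr_sumr -sumrB; apply: eq_bigr => b _.
by rewrite /wedge; ring.
Qed.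

Lemma dotC u v : dot u v = dot v u.
Proof. by apply: eq_bigr => k _; rewrite mulrC. Qed.

Lemma dotDl u v w : dot (fun k => u k + v k) w = dot u w + dot v w.
Proof. by rewrite /dot -big_split; apply: eq_bigr => k _; rewrite /= mulrDl. Qed.

Lemma dotZl r u w : dot (fun k => r * u k) w = r * dot u w.
Proof. by rewrite /dot mulr_sumr; apply: eq_bigr => k _; rewrite mulrA. Qed.

Definition basis_vec (b : 'I_n.+1) : 'I_n.+1 -> R := fun k => (k == b)%:R.

Lemma dot_basis b u : dot (basis_vec b) u = u b.
Proof.
rewrite /dot /basis_vec (bigD1 b)//= eqxx mul1r big1 ?addr0// => k kb.
by rewrite (negbTE kb) mul0r.
Qed.

Lemma on_sphere_dot u : on_sphere u -> dot u u = 1.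
Proof. by move=> <-; apply: eq_bigr => k _; rewrite expr2. Qed.

(** For a unit vector [u], the orthogonal projection of the basis vector [b] on the tangent space at
    [u]. *)
Definition tangent_proj u b : 'I_n.+1 -> R := fun a => (a == b)%:R - u a * u b.

Lemma dot_tangent_proj u b v : dot (tangent_proj u b) v = v b - u b * dot u v.
Proof.
transitivity (dot (basis_vec b) v - u b * dot u v); last by rewrite dot_basis.
rewrite /dot mulr_sumr -sumrB; apply: eq_bigr => k _.
by rewrite /tangent_proj /basis_vec; ring.
Qed.

Lemma act_basis_wedge u b : on_sphere u ->
  act (wedge (basis_vec b) u) u = tangent_proj u b.
Proof.
by move=> su; apply/funext => a; rewrite act_wedge on_sphere_dot// dot_basis mulr1.
Qed.

End Wedge.

(** * Values and tangential derivatives of an orthonormal basis at a point *)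

Section OrthonormalBasis.
Variables (R : realType) (d l N : nat).
Hypothesis d_gt0 : (0 < d)%N.
Local Notation poly := (mpoly.mpoly d.+1 R[i]).
Implicit Types (x u v w : 'I_d.+1 -> R).

Variable P : 'I_N -> poly.
Hypothesis P_harm : forall m, homog_harmonic l (P m).
Hypothesis P_orth : forall m n, sphere_fun (P m * conjp (P n)) = (m == n)%:R.
Hypothesis P_span : forall q : poly, homog_harmonic l q ->
  exists c : 'I_N -> R[i], forall x, on_sphere x ->
    ev x q = \sum_m c m * ev x (P m).

Definition values x : 'I_N -> R[i] := fun m => ev x (P m).

Definition slopes x u : 'I_N -> R[i] := fun m => dirder u x (P m).

(** [P_span] gives equalities on the sphere only; the integral representation shows that
    [sphere_fun] sees nothing else. *)
Lemma sphere_fun_ext (p q : poly) : (forall x, on_sphere x -> ev x p = ev x q) ->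
  sphere_fun p = sphere_fun q.
Proof.
move=> pq; rewrite -!sphere_cint_poly//; congr sphere_cint; apply/funext => th.
by rewrite pq//; exact: xcoord_on_sphere.
Qed.

(** Rotations preserve homogeneous harmonic polynomials, so the images expand in the basis. The
    coefficients are integrals, and the product rule with rotation invariance makes their matrix
    skew-Hermitian. *)
Lemma infrot_matrix A : antisym A -> exists c : 'I_N -> 'I_N -> R[i],
  [/\ skew_hermitian c,
      forall x, on_sphere x -> forall m, ev x (infrot A (P m)) = mulv c (values x) m &
      forall x u, on_sphere x -> dot u x = 0 -> forall m,
        dirder u x (infrot A (P m)) = mulv c (slopes x u) m].
Proof.
move=> aA.
have hP m : homog_harmonic l (infrot A (P m)).
  have [hom lap] := P_harm m; split; first exact: homog_infrot.
  change (laplacian (infrot A (P m)) = 0); rewrite laplacian_infrot//.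
  by rewrite [laplacian _]lap infrot0.
have [c cE] := choice (fun m => P_span (hP m)).
have coef (a : 'I_N -> R[i]) (F : 'I_N -> poly) n :
    (forall k, sphere_fun (F k) = (k == n)%:R) ->
    sphere_fun (\sum_k a k *: F k) = a n.
  move=> FE; rewrite sphere_fun_sum (bigD1 n)//= sphere_funZ FE eqxx mulr1.
  by rewrite big1 ?addr0// => k kn; rewrite sphere_funZ FE (negbTE kn) mulr0.
have sfE m n : sphere_fun (infrot A (P m) * conjp (P n)) = c m n.
  rewrite (@sphere_fun_ext _ (\sum_k c m k *: (P k * conjp (P n)))).
    exact: (coef (fun k => c m k)).
  move=> x sx; rewrite evM cE// [RHS]ev_sum mulr_suml; apply: eq_bigr => k _.
  by rewrite evZ evM mulrA.
(* Since [A] is real, the rotation commutes with conjugation. *)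
have sfE' m n : sphere_fun (P m * infrot A (conjp (P n))) = conjc (c n m).
  rewrite (@sphere_fun_ext _ (\sum_k conjc (c n k) *: (P m * conjp (P k)))).
    by apply: (coef (fun k => conjc (c n k))) => k; rewrite P_orth eq_sym.
  move=> x sx; rewrite evM ev_infrot dirder_conjp -ev_infrot cE// [RHS]ev_sum.
  rewrite rmorph_sum mulr_sumr; apply: eq_bigr => k _.
  by rewrite evZ evM ev_conjp rmorphM mulrCA.
exists c; split=> [m n|x sx m|x u sx ux m].
- by rewrite -sfE -sfE' -raddfD /= -infrotM sphere_fun_infrot.
- by rewrite cE.
- apply/eqP; rewrite -subr_eq0; apply/eqP.
  (* The expansion holds only on the sphere, so just its tangential derivatives can be compared. *)
  pose q : poly := infrot A (P m) + \sum_n (- c m n) *: P n.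
  have <- : dirder u x q = dirder u x (infrot A (P m)) - mulv c (slopes x u) m.
    rewrite /q dirderD; congr (_ + _).
    rewrite dirder_sum /mulv -sumrN; apply: eq_bigr => k _.
    by rewrite dirderZ mulNr.
  apply: dirder_tangent => // y sy.
  rewrite /q evD cE// [X in _ + X]ev_sum -big_split big1// => k _ /=.
  by rewrite evZ mulNr subrr.
Qed.

Lemma slopes_add x u v m : slopes x (fun k => u k + v k) m = slopes x u m + slopes x v m.
Proof. exact: dirder_add. Qed.

Lemma slopes_scale x r u m : slopes x (fun k => r * u k) m = r%:C%C * slopes x u m.
Proof. exact: dirder_scale. Qed.

(* The rotation in the plane of v and w fixes x, so its matrix acts on the
   slopes at x exactly as the rotation acts on tangent vectors. *)
Lemma slopes_orthogonal x v w : on_sphere x -> dot v v = 1 ->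
  dot v x = 0 -> dot w x = 0 -> dot w v = 0 ->
  hform (slopes x w) (slopes x w) = (dot w w)%:C%C * hform (slopes x v) (slopes x v) /\
  hform (slopes x w) (slopes x v) + hform (slopes x v) (slopes x w) = 0.
Proof.
move=> sx v1 vx wx wv; pose A := wedge w v.
have [c [sc _ cE]] := infrot_matrix (antisym_wedge w v).
have Ax a : act A x a = 0 by rewrite act_wedge wx vx !mulr0 subrr.
have dE u m : dot u x = 0 -> mulv c (slopes x u) m = slopes x (act A u) m.
  move=> ux; rewrite -(cE x u sx ux) dirder_infrot [X in _ + X]big1 ?addr0 //.
  by move=> a _; rewrite Ax mul0r.
(* The generator sends [v] to [w], and [w] to [v] scaled by [- dot w w]. *)
have cv : mulv c (slopes x v) = slopes x w.
  apply/funext => m; rewrite (dE _ _ vx); congr slopes; apply/funext => a.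
  by rewrite act_wedge v1 wv mulr1 mulr0 subr0.
have cw : mulv c (slopes x w) = fun m => (- (dot w w))%:C%C * slopes x v m.
  apply/funext => m; rewrite (dE _ _ wx) -slopes_scale; congr slopes; apply/funext => a.
  by rewrite act_wedge dotC wv mulr0 sub0r mulNr mulrC.
split.
  rewrite -{1}cv (hform_skew _ _ sc) cw /hform mulr_sumr -sumrN; apply: eq_bigr => m _.
  by rewrite conjc_realM rmorphN /=; ring.
by rewrite -{1}cv (hform_skew _ _ sc) cv addNr.
Qed.

(** Split [u] into its component along [v] and a remainder orthogonal to [v]; [slopes_orthogonal]
    cancels the cross terms and compares the squares. *)
Lemma hform_slopes_tangent x v u : on_sphere x -> dot v v = 1 -> dot v x = 0 ->
  dot u x = 0 ->
  hform (slopes x u) (slopes x u) = (dot u u)%:C%C * hform (slopes x v) (slopes x v).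
Proof.
move=> sx v1 vx ux; pose r := dot u v; pose w k := u k + (- r) * v k.
have wx : dot w x = 0 by rewrite /w dotDl dotZl ux vx mulr0 addr0.
have wv : dot w v = 0 by rewrite /w dotDl dotZl v1 mulr1 subrr.
have uE : u = fun k => w k + r * v k by apply/funext => k; rewrite /w; ring.
have uu : dot u u = dot w w + r ^+ 2.
  rewrite {1}uE dotDl dotZl -[dot v u]dotC -/r.
  rewrite [dot w u]dotC {1}uE dotDl dotZl [dot v w]dotC wv mulr0 addr0.
  by rewrite expr2.
have [ww wvE] := slopes_orthogonal sx v1 vx wx wv.
transitivity (hform (slopes x w) (slopes x w) + r%:C%C * (hform (slopes x w) (slopes x v)
   + hform (slopes x v) (slopes x w)) + (r ^+ 2)%:C%C * hform (slopes x v) (slopes x v)).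
  rewrite {1 2}uE /hform -big_split /= !mulr_sumr -!big_split; apply: eq_bigr => m _ /=.
  by rewrite slopes_add slopes_scale conjcD conjc_realM rmorphXn /=; ring.
by rewrite ww wvE mulr0 addr0 uu rmorphD mulrDl.
Qed.

(* The squares of the rotations moving x towards the coordinate vectors add up
   to the spherical Laplacian at x, whence the eigenvalue [l (l + d - 1)]. *)
Lemma infrot_casimir x (p : poly) : homog_harmonic l p -> on_sphere x ->
  \sum_b dirder (tangent_proj x b) x (infrot (wedge (basis_vec R b) x) p) =
  - (l * (l + d.-1))%:R * ev x p.
Proof.
move=> [hp lap] sx; pose e := tangent_proj x.
(* The generator turns the tangent vector [e b] back into a radial one, to which Euler's identity
   applies. *)
have eeE b a : act (wedge (basis_vec R b) x) (e b) a = (x b ^+ 2 - 1) * x a.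
  rewrite act_wedge dot_basis dotC dot_tangent_proj on_sphere_dot// mulr1 subrr mulr0.
  by rewrite /e /tangent_proj eqxx mulr1n sub0r expr2; ring.
have termE b : dirder (e b) x (infrot (wedge (basis_vec R b) x) p) =
    (x b ^+ 2 - 1)%:C%C * (l%:R * ev x p) +
    \sum_a (e b a)%:C%C * dirder (e b) x (mpoly.mderiv a p).
  rewrite dirder_infrot act_basis_wedge//; congr (_ + _).
  rewrite -(euler1 x hp) -dirder_scale; congr dirder; apply/funext => a; exact: eeE.
rewrite (eq_bigr _ (fun b _ => termE b)) big_split /= -mulr_suml -rmorph_sum /=.
have -> : \sum_b (x b ^+ 2 - 1) = - d%:R.
  by rewrite sumrB sx sumr_const card_ord -natr1; ring.
(* The tensor squares of the projections sum to the identity minus the radial projector, so the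
   Hessian sum is the Laplacian minus the second radial term. *)
have hess : \sum_b \sum_a (e b a)%:C%C * dirder (e b) x (mpoly.mderiv a p) =
    ev x (laplacian p) - \sum_a (x a)%:C%C * dirder x x (mpoly.mderiv a p).
  pose h a k : R[i] := ev x (mpoly.mderiv k (mpoly.mderiv a p)).
  have ee a k : \sum_b (e b a * e b k) = (a == k)%:R - x a * x k.
    transitivity (dot (tangent_proj x a) (tangent_proj x k)).
      apply: eq_bigr => b _.
      by rewrite /e /tangent_proj (eq_sym a) (eq_sym k); ring.
    rewrite dot_tangent_proj dotC dot_tangent_proj on_sphere_dot// mulr1 subrr mulr0 subr0.
    by rewrite /tangent_proj.
  have E1 : \sum_b \sum_a (e b a)%:C%C * dirder (e b) x (mpoly.mderiv a p) =
      \sum_a \sum_k \sum_b (e b a * e b k)%:C%C * h a k.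
    rewrite exchange_big; apply: eq_bigr => a _.
    rewrite [RHS]exchange_big; apply: eq_bigr => b _ /=.
    rewrite mulr_sumr; apply: eq_bigr => k _.
    by rewrite rmorphM mulrA.
  have E2 : \sum_a (x a)%:C%C * dirder x x (mpoly.mderiv a p) =
      \sum_a \sum_k (x a * x k)%:C%C * h a k.
    apply: eq_bigr => a _; rewrite mulr_sumr; apply: eq_bigr => k _.
    by rewrite rmorphM mulrA.
  have E3 : ev x (laplacian p) = \sum_a \sum_k ((a == k)%:R : R)%:C%C * h a k.
    rewrite /laplacian [LHS]ev_sum; apply: eq_bigr => a _.
    rewrite (bigD1 a)//= eqxx mul1r [X in _ + X]big1 ?addr0// => k ka.
    by rewrite eq_sym (negbTE ka) mul0r.
  rewrite E1 E2 E3; move: h {E1 E2 E3} => h.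
  rewrite -sumrB; apply: eq_bigr => a _; rewrite -sumrB; apply: eq_bigr => k _.
  by rewrite -mulr_suml -rmorph_sum /= ee rmorphB mulrBl.
(* With a harmonic [p] there remains [- d * l - (l ^ 2 - l)], that is [- l * (l + d - 1)]. *)
rewrite hess [laplacian p]lap ev0 sub0r (euler2 x hp) rmorphN rmorph_nat.
rewrite -[in (d%:R : R[i])](prednK d_gt0) natrM natrD -!natr1; ring.
Qed.

(** The squared slopes along all [tangent_proj x b] are summed twice: by isotropy, with total
    squared length [d], and by moving a rotation across the form, which produces the eigenvalue. *)
Lemma hform_slopes x v : on_sphere x -> dot v v = 1 -> dot v x = 0 ->
  d%:R * hform (slopes x v) (slopes x v) =
  (l * (l + d.-1))%:R * hform (values x) (values x).
Proof.
move=> sx v1 vx; pose e := tangent_proj x.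
have ex b : dot (e b) x = 0.
  by rewrite dot_tangent_proj on_sphere_dot// mulr1 subrr.
have ee b : dot (e b) (e b) = 1 - x b ^+ 2.
  by rewrite dot_tangent_proj [dot x _]dotC ex mulr0 subr0 /e /tangent_proj eqxx expr2.
have sum1 : \sum_b hform (slopes x (e b)) (slopes x (e b)) =
    d%:R * hform (slopes x v) (slopes x v).
  under eq_bigr => b _ do rewrite (hform_slopes_tangent sx v1 vx (ex b)) ee.
  rewrite -mulr_suml -rmorph_sum sumrB sx sumr_const card_ord -natr1 addrK.
  by rewrite rmorph_nat.
rewrite -sum1.
have sum2 b : hform (slopes x (e b)) (slopes x (e b)) =
    - \sum_m values x m *
      conjc (dirder (e b) x (infrot (wedge (basis_vec R b) x) (P m))).
  have [c [sc cE cE']] := infrot_matrix (antisym_wedge (basis_vec R b) x).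
  have cv : mulv c (values x) = slopes x (e b).
    by apply/funext => m; rewrite -(cE x sx) ev_infrot act_basis_wedge.
  rewrite -{1}cv (hform_skew _ _ sc); congr (- _); apply: eq_bigr => m _.
  by rewrite (cE' x _ sx (ex b)).
rewrite (eq_bigr _ (fun b _ => sum2 b)) sumrN exchange_big -sumrN /= /hform mulr_sumr.
apply: eq_bigr => m _.
rewrite -mulr_sumr -rmorph_sum infrot_casimir// rmorphM rmorphN.
by rewrite rmorph_nat /values; ring.
Qed.

Definition density_poly : poly := \sum_m P m * conjp (P m).

Lemma ev_density x : ev x density_poly = hform (values x) (values x).
Proof. by rewrite ev_sum; apply: eq_bigr => m _; rewrite evM ev_conjp. Qed.

(** The rotation in the plane of [u] and [x] moves [x] in direction [u]; skewness of its matrix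
    makes the two terms of the product rule cancel. *)
Lemma dirder_density x u : on_sphere x -> dot u x = 0 -> dirder u x density_poly = 0.
Proof.
move=> sx ux; have [c [sc cE _]] := infrot_matrix (antisym_wedge u x).
have cv : mulv c (values x) = slopes x u.
  apply/funext => m; rewrite -(cE x sx) ev_infrot; congr dirder; apply/funext => a.
  by rewrite act_wedge on_sphere_dot// ux mulr1 mulr0 subr0.
transitivity (hform (slopes x u) (values x) + hform (values x) (slopes x u)).
  rewrite dirder_sum -big_split; apply: eq_bigr => m _ /=.
  by rewrite dirderM ev_conjp dirder_conjp.
by rewrite -cv (hform_skew _ _ sc) addNr.
Qed.

Lemma density_upd theta j s : (0 < j <= d)%N ->
  ev (@xcoord R d (upd theta j s)) density_poly = ev (@xcoord R d theta) density_poly.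
Proof.
move=> jd.
have updE : upd theta j (theta j) = theta.
  by apply/funext => i; rewrite /upd; case: eqP => [->|].
have dz t : cderive (fun s => ev (@xcoord R d (upd theta j s)) density_poly) t 0.
  have [tau [dtau _ tx]] := xcoord_derive (upd theta j t) jd.
  have updU s' : upd (upd theta j t) j s' = upd theta j s'.
    by apply/funext => i; rewrite /upd; case: eqP.
  have dtau' k : is_derive t 1 (fun s' => @xcoord R d (upd theta j s') k) (tau k).
    have := dtau k; rewrite [upd theta j t j]/upd eqxx; congr is_derive; apply/funext => s'.
    by rewrite updU.
  have := cderive_ev density_poly dtau'.
  by rewrite (dirder_density (xcoord_on_sphere (upd theta j t) d_gt0) tx).
rewrite -[in RHS]updE; apply/eqP; rewrite eq_complex.
apply/andP; split; apply/eqP.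
  pose f t := complex.Re (ev (@xcoord R d (upd theta j t)) density_poly).
  by apply: (@is_derive_0_is_cst R f) => t; have [] := dz t.
pose f t := complex.Im (ev (@xcoord R d (upd theta j t)) density_poly).
by apply: (@is_derive_0_is_cst R f) => t; have [] := dz t.
Qed.

Lemma eq_xcoord (th th' : nat -> R) : (forall i, (0 < i <= d)%N -> th i = th' i) ->
  @xcoord R d th = @xcoord R d th'.
Proof.
move=> E; apply/funext => k; rewrite /xcoord.
have prodE m : (0 < m)%N ->
    \prod_(m <= i < d.+1) sin (th i) = \prod_(m <= i < d.+1) sin (th' i).
  move=> m0; rewrite !big_nat; apply: eq_bigr => i /andP[mi id].
  by rewrite E// (leq_trans m0).
rewrite !prodE// (E 1%N)//; case: ifP => // k0; case: ifP => // _.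
by rewrite (E (val k))// lt0n k0 -ltnS ltn_ord.
Qed.

Lemma density_constant (th th' : nat -> R) :
  ev (@xcoord R d th) density_poly = ev (@xcoord R d th') density_poly.
Proof.
(* The angles are replaced one at a time, each change being covered by [density_upd]. *)
pose mix k := fun i => if (i <= k)%N then th i else th' i.
have mixE k : (k <= d)%N ->
    ev (@xcoord R d (mix k)) density_poly = ev (@xcoord R d th') density_poly.
  elim: k => [|k IH] kd.
    by congr ev; apply: eq_xcoord => i /andP[i0 _]; rewrite /mix leqNgt i0.
  apply: (eq_trans _ (IH (ltnW kd))).
  apply: (eq_trans _ (@density_upd (mix k) k.+1 (th k.+1) kd)).
  congr ev; apply: eq_xcoord => i _; rewrite /mix /upd leq_eqVlt ltnS.
  by case: eqP => [->|].
apply: (eq_trans _ (mixE d (leqnn d))); congr ev; apply: eq_xcoord => i /andP[_ id].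
by rewrite /mix id.
Qed.

(** The density is integrated twice: as a constant, and term by term, where each basis element
    contributes 1. *)
Lemma density_area theta :
  hform (values (@xcoord R d theta)) (values (@xcoord R d theta)) *
    (sphere_area R d)%:C%C = N%:R.
Proof.
rewrite -ev_density; set c0 := ev _ _.
have <- : sphere_fun density_poly = N%:R.
  rewrite sphere_fun_sum.
  under eq_bigr => m _ do rewrite P_orth eqxx.
  by rewrite sumr_const card_ord.
have s1 : sphere_fun (1 : poly) = (sphere_area R d)%:C%C.
  (* The functional at 1 is a real moment, so comparing real parts is enough. *)
  have H : complex.Re (sphere_fun (1 : poly)) = sphere_area R d.
    rewrite -sphere_cint_poly// /sphere_cint /sphere_area /=; congr sphere_int.
    by apply/funext => th; rewrite /ev mpoly.meval1.
  by rewrite -H -mpoly.mpolyX0 sphere_funX.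
rewrite -s1 -sphere_funZ -!sphere_cint_poly//; congr sphere_cint; apply/funext => th.
by rewrite evZ [ev _ 1]mpoly.meval1 mulr1; exact: density_constant.
Qed.

End OrthonormalBasis.

(** * Gegenbauer polynomials at 1 *)

Section Gegenbauer.
Variable R : realType.

(** The product is the standard value [(2 alpha)_n / n!]. The induction carries both components of
    the pair, as the recurrence has order two. *)
Lemma gegenbauer1 (alpha : R) n :
  gegenbauer alpha n 1 = \prod_(i < n) ((2 * alpha + i%:R) / i.+1%:R).
Proof.
pose G n : R := \prod_(i < n) ((2 * alpha + i%:R) / i.+1%:R).
have Gr k : G k.+1 = G k * ((2 * alpha + k%:R) / k.+1%:R) by rewrite /G big_ord_recr.
rewrite /gegenbauer -/(G n).
suff -> : gegenbauer_pair alpha 1 n = (G n, G n.+1) by [].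
elim: n => [|n IH] /=; first by rewrite Gr /G big_ord0 divr1 addr0 mulr1 mul1r.
rewrite IH; congr (_, _); rewrite !Gr.
have n1 : (n.+1%:R : R) != 0 by rewrite pnatr_eq0.
have n2 : (n.+2%:R : R) != 0 by rewrite pnatr_eq0.
by move: n1 n2; rewrite -[n.+2]addn2 -[n.+1]addn1 !natrD => n1 n2; field; rewrite n1 n2.
Qed.

Lemma gegenbauer1_neq0 d l : (1 < d)%N -> gegenbauer ((d%:R - 1) / 2) l (1 : R) != 0.
Proof.
move=> d1; rewrite gegenbauer1; apply/prodf_neq0 => i _.
rewrite mulf_neq0 ?invr_eq0 ?pnatr_eq0// mulrC mulfVK ?pnatr_eq0//.
apply: lt0r_neq0; apply: ltr_pwDl => //.
by rewrite subr_gt0 ltr1n.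
Qed.

(** For positive [l], both sides equal the rising factorial of [d - 1] of length [l + 1] divided by
    [(l - 1)!]. At [l = 0] the convention for degree -1 makes both zero. *)
Lemma gegenbauer1_shift d l : (0 < d)%N ->
  d%:R * ((d%:R - 1) * gegenbauer_pred ((d%:R + 1) / 2) l 1) =
  (l * (l + d.-1))%:R * gegenbauer ((d%:R - 1) / 2) l (1 : R).
Proof.
move=> d0; case: l => [|l]; first by rewrite mul0n mul0r /= !mulr0.
have -> : (l.+1 + d.-1 = l + d)%N by lia.
have d_neq0 : (d%:R : R) != 0 by rewrite pnatr_eq0 -lt0n.
rewrite [gegenbauer_pred _ _ _]gegenbauer1 gegenbauer1.
have two (z : R) : 2 * (z / 2) = z by field.
under eq_bigr do rewrite two; under [in RHS]eq_bigr do rewrite two.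
elim: l => [|l IH].
  rewrite big_ord0 big_ord_recr big_ord0 /= mul1n add0n; rewrite mul1r addr0 divr1; ring.
rewrite big_ord_recr [in RHS]big_ord_recr /= !mulrA -(mulrA d%:R) IH.
have l1 : (l.+1%:R : R) != 0 by rewrite pnatr_eq0.
have l2 : (l.+2%:R : R) != 0 by rewrite pnatr_eq0.
move: l1 l2; rewrite !natrM !natrD -[l.+2]addn2 -[l.+1]addn1 !natrD => l1 l2.
by field; rewrite l1 l2.
Qed.

End Gegenbauer.

(** * Angular derivatives and their sum over the basis *)

Lemma sqmodE (R : realType) (z : R[i]) : (sqmod z)%:C%C = z * conjc z.
Proof. by case: z => a b; rewrite /sqmod /=; simpc; congr Complex; ring. Qed.

Section ThetaDerivative.
Variables (R : realType) (d j : nat) (theta : nat -> R).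
Hypothesis jd : (0 < j <= d)%N.

Lemma dtheta_dirder (Y : ('I_d.+1 -> R) -> R[i]) (p : mpoly.mpoly d.+1 R[i])
    (tau : 'I_d.+1 -> R) :
  (forall x, on_sphere x -> Y x = ev x p) ->
  (forall k, is_derive (theta j) 1 (fun s => xcoord (upd theta j s) k) (tau k)) ->
  dtheta j Y theta = dirder tau (@xcoord R d theta) p.
Proof.
move=> Yp dtau; have d0 : (0 < d)%N by case/andP: jd; exact: leq_trans.
have := cderive_ev p dtau.
have -> : upd theta j (theta j) = theta.
  by apply/funext => i; rewrite /upd; case: eqP => [->|].
have gE t : Y (@xcoord R d (upd theta j t)) = ev (@xcoord R d (upd theta j t)) p.
  by apply: Yp; exact: xcoord_on_sphere.
move=> [dr di]; rewrite /dtheta.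
apply/eqP; rewrite eq_complex /=; apply/andP; split; apply/eqP.
  have -> : (fun t => complex.Re (Y (@xcoord R d (upd theta j t)))) =
      (fun t => complex.Re (ev (@xcoord R d (upd theta j t)) p)).
    by apply/funext => t; rewrite gE.
  by rewrite derive1E; exact: derive_val.
have -> : (fun t => complex.Im (Y (@xcoord R d (upd theta j t)))) =
    (fun t => complex.Im (ev (@xcoord R d (upd theta j t)) p)).
  by apply/funext => t; rewrite gE.
by rewrite derive1E; exact: derive_val.
Qed.

End ThetaDerivative.

Theorem theorem2p1 (R : realType) (d l : nat) (hd : (3 <= d)%N)
    (Y : 'I_(Nsh d l) -> ('I_d.+1 -> R) -> R[i])
    (hY : sph_harm_ONB l Y)
    (j : nat) (hj : (1 <= j <= d)%N)
    (theta : nat -> R)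
    (h1 : 0 <= theta 1%N < 2 * pi)
    (hsing : forall k : nat, (2 <= k <= d)%N -> 0 < theta k < pi) :
  \sum_(m < Nsh d l) (eta d j theta ^+ 2)^-1 * sqmod (dtheta j (Y m) theta)
  = (d%:R - 1) * Kconst R d l * gegenbauer_pred ((d%:R + 1) / 2) l 1.
Proof.
have d0 : (0 < d)%N by exact: leq_trans hd.
have [Yharm Yorth Yspan] := hY.
have [P PP] := choice Yharm.
have P_harm m : homog_harmonic l (P m) by have [] := PP m.
have YP m x : on_sphere x -> Y m x = ev x (P m) by have [_] := PP m; exact.
have P_orth m n : sphere_fun (P m * conjp (P n)) = (m == n)%:R.
  rewrite -Yorth -sphere_cint_poly// /L2dot; congr sphere_cint; apply/funext => th.
  have sx := xcoord_on_sphere th d0.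
  by rewrite evM ev_conjp (YP m _ sx) (YP n _ sx).
have P_span (q : mpoly.mpoly d.+1 R[i]) : homog_harmonic l q ->
    exists c : 'I_(Nsh d l) -> R[i], forall x, on_sphere x ->
      ev x q = \sum_m c m * ev x (P m).
  move=> hq; have [|c cE] := Yspan (fun x => ev x q); first by exists q.
  exists c => x sx; apply: (eq_trans (cE x sx)); apply: eq_bigr => m _.
  by rewrite (YP m _ sx).
have [tau [dtau tautau taux]] := xcoord_derive theta hj.
pose e := eta d j theta; pose x := @xcoord R d theta.
(* Only angles of index above [j], hence at least 2, enter [eta]; their sines are positive away from
   the singularities. *)
have e0 : e != 0.
  rewrite /e /eta prodf_seq_neq0; apply/allP => k; rewrite mem_index_iota => /andP[jk kd].
  apply/implyP => _; apply: lt0r_neq0; apply: sin_gt0_pi; apply: hsing.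
  by rewrite (leq_ltn_trans _ jk)//; case/andP: hj.
have sx : on_sphere x by exact: xcoord_on_sphere.
(* Dividing by [eta] normalises the coordinate tangent vector, which accounts for the weight in the
   sum. *)
pose v k := e^-1 * tau k.
have v1 : dot v v = 1.
  by rewrite dotZl dotC dotZl tautau -/e; field.
have vx : dot v x = 0 by rewrite dotZl taux mulr0.
have main := hform_slopes d0 P_harm P_orth P_span sx v1 vx.
have area := density_area d0 P_harm P_orth P_span theta.
set S := \sum_(m < _) _.
have SE : S%:C%C = hform (slopes P x v) (slopes P x v).
  rewrite rmorph_sum; apply: eq_bigr => m _.
  rewrite (dtheta_dirder hj (YP m) dtau) rmorphM /= sqmodE.
  rewrite slopes_scale conjc_realM /slopes -exprVn rmorphXn /=; ring.
have key : d%:R * S * sphere_area R d = (l * (l + d.-1))%:R * (Nsh d l)%:R.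
  apply: complexI; rewrite !rmorphM !rmorph_nat /= SE main -area; ring.
have [N0|N0] := eqVneq (Nsh d l) 0%N.
  rewrite /Kconst N0 !mul0r mulr0 mul0r /S big1// => m _.
  have : (0 < Nsh d l)%N by exact: leq_ltn_trans (leq0n _) (ltn_ord m).
  by rewrite N0.
(* Positivity of the area is not computed: a zero area contradicts [area] once the dimension is
   nonzero. *)
have [L0|L0] := eqVneq (sphere_area R d) 0.
  have : (Nsh d l)%:R = 0 :> R[i] by rewrite -area L0 mulr0.
  by move/eqP; rewrite pnatr_eq0 (negbTE N0).
have g0 := gegenbauer1_neq0 R l (leq_trans (isT : (1 < 3)%N) hd).
have shift := gegenbauer1_shift R l d0.
have dR0 : (d%:R : R) != 0 by rewrite pnatr_eq0 -lt0n.
(* After multiplication by [d] and the area, [key] evaluates the left side and [shift] supplies the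
   same eigenvalue on the right. *)
apply: (mulfI (mulf_neq0 dR0 L0)).
rewrite mulrAC key /Kconst.
move: shift g0; set g := gegenbauer _ _ _; set g' := gegenbauer_pred _ _ _ => shift g0.
transitivity ((d%:R * ((d%:R - 1) * g')) * (Nsh d l)%:R / g); last by field; rewrite L0 g0.
by rewrite shift; field.
Qed.
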